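(* Let $0<\sigma_1^2<\sigma_2^2$, assume Assumption (A) stated in the context, and let $c$ be a real number with $0\le c \le c(\sigma_1^2,\sigma_2^2)$. Then \[ \lim_{n \to \infty} \frac{C_s(\sigma_1^2, \sigma_2^2, c \sqrt{n},n )}{n} = \frac{1}{2} \log \left( \frac{1+c^2/\sigma_1^2}{ 1+c^2/\sigma_2^2} \right). \]
   Context: Vector Gaussian wiretap channel in dimension $n$: $\mathbf{Y}_1=\mathbf{X}+\mathbf{N}_1$, $\mathbf{Y}_2=\mathbf{X}+\mathbf{N}_2$, $\mathbf{N}_1\sim\mathcal{N}(\mathbf{0}_n,\sigma_1^2\mathbf{I}_n)$, $\mathbf{N}_2\sim\mathcal{N}(\mathbf{0}_n,\sigma_2^2\mathbf{I}_n)$, mutually independent with $\mathbf{X}\in\mathbb{R}^n$. $C_s(\sigma_1^2,\sigma_2^2,\mathsf{R},n)=\max I(\mathbf{X};\mathbf{Y}_1)-I(\mathbf{X};\mathbf{Y}_2)$ over distributions of $\mathbf{X}$ supported in $\{\|\mathbf{x}\|\le\mathsf{R}\}$. $c(\sigma_1^2,\sigma_2^2)$ denotes the solution $c$ of $\int_{\sigma_1^2}^{\sigma_2^2} \frac{ \frac{c^2 }{ ( \frac{\sqrt{s}}{2}+\sqrt{ \frac{s}{4} + c^2} )^2} + \frac{ c^2 (c^2+ s)}{ ( \frac{s}{2}+\sqrt{ \frac{s^2}{4} +c^2( c^2+ s) } )^2} -1}{s^2} \mathrm{d} s =0$. $\mathsf{h}_v(x)=\mathsf{I}_v(x)/\mathsf{I}_{v-1}(x)$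 with $\mathsf{I}_v$ the modified Bessel function of the first kind. Assumption (A): for all $\mathsf{R}\ge0$, $0\le\sigma_1\le\sigma_2$, $n\in\mathbb{N}$, the function $y\mapsto \frac{1}{\sigma_2^2}\mathbb{E}\left[\frac{\mathsf{R}}{\|y\mathbf{e}_1+\mathbf{W}\|}\mathsf{h}_{\frac{n}{2}}\left(\frac{\mathsf{R}}{\sigma_2^2}\|y\mathbf{e}_1+\mathbf{W}\|\right)-1\right]-\frac{1}{\sigma_1^2}\left(\frac{\mathsf{R}}{y}\mathsf{h}_{\frac{n}{2}}\left(\frac{\mathsf{R}}{\sigma_1^2}y\right)-1\right)$ has at most one sign change on $y>0$, where $\mathbf{W}\sim\mathcal{N}(\mathbf{0}_{n+2},(\sigma_2^2-\sigma_1^2)\mathbf{I}_{n+2})$ and $\mathbf{e}_1$ is the first unit vector of $\mathbb{R}^{n+2}$. *)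

(* Defs.v *)
From HB Require Import structures.
From mathcomp Require Import all_boot all_order all_algebra.
From mathcomp Require Import all_classical all_reals all_analysis.

Set Implicit Arguments.
Unset Strict Implicit.
Unset Printing Implicit Defensive.

Import Order.TTheory GRing.Theory Num.Theory.
Import numFieldNormedType.Exports.

Local Open Scope classical_set_scope.
Local Open Scope ring_scope.

Section Defs.
Variable R : realType.

(** Vectors of R^n are represented as n-tuples (which carry the product
    sigma-algebra generated by the coordinate projections). *)

Definition enorm n (x : n.-tuple R) : R :=
  Num.sqrt (\sum_(i < n) tnth x i ^+ 2).

Definition tsub n (x y : n.-tuple R) : n.-tuple R :=
  [tuple tnth x i - tnth y i | i < n].

Definition shift_e1 n (y : R) (w : n.-tuple R) : n.-tuple R :=
  [tuple tnth w i + (if nat_of_ord i == 0%N then y else 0) | i < n].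

(** Integral over R^n with respect to Lebesgue measure, written as the
    iterated integral over the n coordinates (Lebesgue measure on R^n is the
    n-fold product of the one-dimensional Lebesgue measure). *)
Fixpoint int_Rn (n : nat) : (n.-tuple R -> \bar R) -> \bar R :=
  match n return (n.-tuple R -> \bar R) -> \bar R with
  | 0%N => fun f => f [tuple]
  | n'.+1 => fun f =>
      (\int[@lebesgue_measure R]_x int_Rn (fun t => f [tuple of x :: t]))%E
  end.

Definition gauss_dens n (v : R) (z : n.-tuple R) : R :=
  (Num.sqrt (pi *+ 2 * v)) ^- n * expR (- (enorm z ^+ 2) / (v *+ 2)).

(** Output density of Y = X + N, N ~ N(0, v I_n) independent of X ~ P. *)
Definition out_dens n (v : R) (P : probability (n.-tuple R) R)
    (y : n.-tuple R) : R :=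
  fine (\int[P]_x (gauss_dens v (tsub y x))%:E)%E.

(** Mutual information I(X; X + N), N ~ N(0, v I_n), X ~ P, computed as
    E_X [ D( P_{Y|X} || P_Y ) ] = int int p(y|x) ln (p(y|x)/p(y)) dy dP(x)
    (natural logarithm). *)
Definition mutual_info n (v : R) (P : probability (n.-tuple R) R) : \bar R :=
  (\int[P]_x int_Rn (fun y =>
      (gauss_dens v (tsub y x) *
       ln (gauss_dens v (tsub y x) / out_dens v P y))%:E))%E.

Definition ball_inputs n (r : R) : set (probability (n.-tuple R) R) :=
  [set P | P [set x | enorm x <= r] = 1%E].

Definition Cs (v1 v2 r : R) (n : nat) : \bar R :=
  ereal_sup [set (mutual_info v1 P - mutual_info v2 P)%E
            | P in @ball_inputs n r].

Definition Gamma (s : R) : R :=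
  fine (\int[@lebesgue_measure R]_(t in [set t : R | (0 < t)%R])
          (powR t (s - 1) * expR (- t))%:E)%E.

Definition besselI (v x : R) : R :=
  limn (fun N => \sum_(k < N)
    powR (x / 2) (k%:R *+ 2 + v) / (k`!%:R * Gamma (k%:R + v + 1))).

Definition hB (v x : R) : R := besselI v x / besselI (v - 1) x.

Definition gauss_expect n (v : R) (f : n.-tuple R -> R) : R :=
  fine (int_Rn (fun w => (gauss_dens v w * f w)%:E)).

Definition at_most_one_sign_change (f : R -> R) : Prop :=
  ~ exists y1 y2 y3, [/\ 0 < y1, y1 < y2, y2 < y3 &
      (0 < f y1 /\ f y2 < 0 /\ 0 < f y3) \/
      (f y1 < 0 /\ 0 < f y2 /\ f y3 < 0)].

Definition assumA_fun (r v1 v2 : R) (n : nat) (y : R) : R :=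
  v2^-1 * gauss_expect (v2 - v1)
     (fun w : n.+2.-tuple R =>
        r / enorm (shift_e1 y w) *
        hB (n%:R / 2) (r / v2 * enorm (shift_e1 y w)) - 1)
  - v1^-1 * (r / y * hB (n%:R / 2) (r / v1 * y) - 1).

Definition assumptionA : Prop :=
  forall (r v1 v2 : R) (n : nat), 0 <= r -> 0 < v1 -> v1 < v2 -> (0 < n)%N ->
    at_most_one_sign_change (assumA_fun r v1 v2 n).

Definition cstar_integrand (c s : R) : R :=
  (c ^+ 2 / (Num.sqrt s / 2 + Num.sqrt (s / 4 + c ^+ 2)) ^+ 2
   + c ^+ 2 * (c ^+ 2 + s) /
       (s / 2 + Num.sqrt (s ^+ 2 / 4 + c ^+ 2 * (c ^+ 2 + s))) ^+ 2
   - 1) / s ^+ 2.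

Definition is_cstar (v1 v2 c : R) : Prop :=
  (\int[@lebesgue_measure R]_(s in `[v1, v2]) (cstar_integrand c s)%:E)%E
    = 0%E.

End Defs.

(* Main.v *)
(** For every [t >= 0] the mutual information of a bounded input [X] of law [P]
    satisfies
    [I(X; X + N_v) = n/2 ln ((t + v)/v) + (E|X|^2 - n t)/(2 (t + v)) - D_v],
    where [D_v] is the relative entropy of the output density with respect to
    the centred Gaussian density of variance [t + v].

    Upper bound: take [t = c^2] and subtract the formulas for [v1] and [v2].
    The second term has slope [1/(t + v1) - 1/(t + v2) >= 0] in [E|X|^2 <= n t],
    and [D_v2 <= D_v1] because the second output is the first one plus
    independent Gaussian noise (data processing).

    Lower bound: for [a < t < c^2] let [X] be Gaussian of variance [t]
    conditioned on the shell [n a <= |x|^2 <= n c^2].  By a Chernoff bound the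
    shell has probability at least 1/2 for large [n], so the output density is
    at most twice the Gaussian one and [D_v1 <= ln 2], while [D_v2 >= 0] and
    [E|X|^2 >= n a].  Divide by [n] and let [a, t] tend to [c^2]. *)
Require Import Defs.
From HB Require Import structures.
From mathcomp Require Import all_boot all_order all_algebra.
From mathcomp Require Import all_classical all_reals all_analysis measurable_realfun.
From mathcomp Require Import ring lra.
Import Order.TTheory GRing.Theory Num.Theory.
Import numFieldNormedType.Exports.
Local Open Scope classical_set_scope.
Local Open Scope ring_scope.
Set Implicit Arguments.
Unset Strict Implicit.
Unset Printing Implicit Defensive.

(** * Product measures on tuples *)

(** [int_Rn] is an iterated integral and the integrand of [mutual_info] changes sign, so splitting
    integrals and exchanging their order requires absolute integrability. Bounded support supplies
    it: the output density lies between two Gaussian-shaped functions, hence its logarithm grows at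
    most quadratically, and a Gaussian factor absorbs quadratic growth. The predicate [gdom] carries
    this through the development.

    The two bounds choose [t] differently for a reason. At [t = c^2] the power term is nonpositive
    for every admissible input. In the lower bound [t] stays strictly below [c^2], because the
    exponential tail bound is nontrivial only away from the typical radius [sqrt (n t)]; the inner
    radius of the shell bounds the power of the conditioned input from below without computing it.
    Conditioning costs at most [ln 2] in every dimension, which disappears after division by [n].
    The remaining losses per dimension are linear in [t - a] and [c^2 - t], so these gaps can be
    fixed before [n] grows. *)

Section pushforward_iso.
Local Open Scope ereal_scope.
Context d1 d2 (T1 : measurableType d1) (T2 : measurableType d2) (R : realType).
Variables (m : set T1 -> \bar R) (f : T1 -> T2) (g : T2 -> T1).
Hypotheses (mg : measurable_fun setT g) (fK : cancel f g).

(** Sets of finite mass are pulled back along [g]; because [g (f x) = x], the pushforward gives each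
    pullback the mass of the original set. *)
Lemma sigma_finite_pushforward :
  sigma_finite setT m -> sigma_finite setT (pushforward m f).
Proof.
move=> [F TF Foo].
exists (fun k => g @^-1` F k).
  by rewrite -preimage_bigcup -TF preimage_setT.
move=> k; have [mF Fk] := Foo k; split.
  by rewrite -[X in measurable X]setTI; exact: mg.
rewrite /pushforward; congr (_ < _) : Fk; congr (m _).
by apply/seteqP; split => x /=; rewrite fK.
Qed.

End pushforward_iso.

Section tuple_measure.
Local Open Scope ereal_scope.
Context d (T : measurableType d) (R : realType).

Definition tcons n (z : T * n.-tuple T) : n.+1.-tuple T :=
  [tuple of z.1 :: z.2].

Lemma measurable_tcons n : measurable_fun setT (@tcons n).
Proof. by apply: measurable_cons. Qed.

HB.instance Definition _ n :=
  isMeasurableFun.Build _ _ _ _ (@tcons n) (@measurable_tcons n).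

Definition tuncons n (t : n.+1.-tuple T) : T * n.-tuple T :=
  (thead t, [tuple of behead t]).

Lemma measurable_tuncons n : measurable_fun setT (@tuncons n).
Proof.
apply/measurable_fun_pairP; split.
  exact: (measurable_tnth (ord0 : 'I_n.+1)).
exact: measurable_behead.
Qed.

Lemma tconsK n : cancel (@tcons n) (@tuncons n).
Proof.
move=> [x t]; rewrite /tcons /tuncons /=; congr pair.
exact/val_inj.
Qed.

Section consmeas.
Variables (n : nat) (m : {sigma_finite_measure set T -> \bar R}).
Variable mn : {sigma_finite_measure set (n.-tuple T) -> \bar R}.

Definition consmeas := pushforward (m \x mn) (@tcons n).

Let consmeas0 : consmeas set0 = 0. Proof. exact: measure0. Qed.

Let consmeas_ge0 A : 0 <= consmeas A. Proof. exact: measure_ge0. Qed.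

Let consmeas_sigma_additive : semi_sigma_additive consmeas.
Proof. exact: measure_semi_sigma_additive. Qed.

HB.instance Definition _ := isMeasure.Build _ _ _ consmeas
  consmeas0 consmeas_ge0 consmeas_sigma_additive.

Lemma sigma_finite_consmeas : sigma_finite setT consmeas.
Proof.
apply: (sigma_finite_pushforward (@measurable_tuncons n) (@tconsK n)).
have /sigma_finiteP[F [TF ndF Foo]] := sigma_finiteT m.
have /sigma_finiteP[G [TG ndG Goo]] := sigma_finiteT mn.
(* Both families are nondecreasing, so the diagonal rectangles already exhaust the product. *)
exists (fun k => F k `*` G k).
  apply/esym; rewrite -subTset => -[x y] _.
  have [i _ Fx] : (\bigcup_i F i) x by rewrite -TF.
  have [j _ Gy] : (\bigcup_i G i) y by rewrite -TG.
  exists (maxn i j) => //; split.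
  - by move: x Fx; exact/subsetPset/ndF/leq_maxl.
  - by move: y Gy; exact/subsetPset/ndG/leq_maxr.
move=> k; have [? ?] := Foo k; have [? ?] := Goo k.
split; first exact: measurableX.
by rewrite product_measure1E// lte_mul_pinfty// ge0_fin_numE.
Qed.

HB.instance Definition _ :=
  Measure_isSigmaFinite.Build _ _ _ consmeas sigma_finite_consmeas.

End consmeas.

(** Coordinates are added at the head, as in the recursion of [int_Rn], so that the two can be
    compared by induction on the dimension. *)
Fixpoint tmeas (m : {sigma_finite_measure set T -> \bar R}) n :
    {sigma_finite_measure set (n.-tuple T) -> \bar R} :=
  match n return {sigma_finite_measure set (n.-tuple T) -> \bar R} with
  | 0%N => \d_([tuple] : 0.-tuple T)
  | n'.+1 => consmeas m (tmeas m n')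
  end.

Variable m : {sigma_finite_measure set T -> \bar R}.

Lemma integral_tmeas0 (h : 0.-tuple T -> \bar R) :
  measurable_fun [set: 0.-tuple T] h -> \int[tmeas m 0]_t h t = h [tuple].
Proof. by move=> mh; rewrite /= integral_dirac// diracT mul1e. Qed.

Lemma ge0_integral_tmeasS n (h : n.+1.-tuple T -> \bar R) :
  measurable_fun [set: n.+1.-tuple T] h -> (forall t, 0 <= h t) ->
  \int[tmeas m n.+1]_t h t = \int[m]_x \int[tmeas m n]_t h (tcons (x, t)).
Proof.
move=> mh h0; rewrite /= (ge0_integral_pushforward (@measurable_tcons n))//.
rewrite preimage_setT fubini_tonelli1//=.
by apply: measurableT_comp => //; exact: measurable_tcons.
Qed.

Lemma integrable_tcons n (h : n.+1.-tuple T -> \bar R) :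
  (tmeas m n.+1).-integrable setT h ->
  (m \x tmeas m n).-integrable setT (h \o @tcons n).
Proof.
move=> ih; have mh := measurable_int _ ih.
apply/integrableP; split.
  by apply: measurableT_comp => //; exact: measurable_tcons.
have /integrableP[_] := ih.
rewrite /= (ge0_integral_pushforward (@measurable_tcons n))//.
exact: measurableT_comp.
Qed.

Lemma integral_tmeasS n (h : n.+1.-tuple T -> \bar R) :
  (tmeas m n.+1).-integrable setT h ->
  \int[tmeas m n.+1]_t h t = \int[m]_x \int[tmeas m n]_t h (tcons (x, t)).
Proof.
move=> ih; have mh := measurable_int _ ih; have ihc := integrable_tcons ih.
rewrite /= (integral_pushforward (@measurable_tcons n))//.
by rewrite preimage_setT -integral12_prod_meas1.
Qed.

(** Normalisation, convolution and tilting of Gaussian vectors all factor over the coordinates; this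
    reduces each of them to a one-dimensional identity. *)
Lemma integral_tmeas_prod n (u : 'I_n -> T -> R) (c : 'I_n -> R) :
  (forall i, measurable_fun setT (u i)) -> (forall i x, (0 <= u i x)%R) ->
  (forall i, \int[m]_x (u i x)%:E = (c i)%:E) ->
  \int[tmeas m n]_t (\prod_(i < n) u i (tnth t i))%:E = (\prod_(i < n) c i)%:E.
Proof.
have mprod k (w : 'I_k -> T -> R) : (forall i, measurable_fun setT (w i)) ->
    measurable_fun setT (fun t : k.-tuple T => \prod_(i < k) w i (tnth t i))%R.
  move=> mw; apply: measurable_prod => i _.
  by apply: measurableT_comp => //; exact: measurable_tnth.
elim: n u c => [|n IH] u c mu u0 uc.
  rewrite integral_tmeas0 ?big_ord0//.
  by apply/measurable_EFinP; exact: mprod.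
rewrite ge0_integral_tmeasS; last 2 first.
- by apply/measurable_EFinP; exact: mprod.
- by move=> t; rewrite lee_fin; apply: prodr_ge0.
pose v i := u (lift ord0 i); pose e i := c (lift ord0 i).
have mv : measurable_fun setT (fun t : n.-tuple T => \prod_i v i (tnth t i))%R.
  by apply: mprod => i; exact: mu.
have v0 (t : n.-tuple T) : (0 <= \prod_i v i (tnth t i))%R
  by apply: prodr_ge0 => i _; exact: u0.
have IHv : \int[tmeas m n]_t (\prod_i v i (tnth t i))%:E = (\prod_i e i)%:E.
  by apply: IH => i; [exact: mu|move=> x; exact: u0|exact: uc].
transitivity (\int[m]_x ((u ord0 x)%:E * (\prod_i e i)%:E)).
  apply: eq_integral => x _; rewrite -IHv -ge0_integralZl//.
  - apply: eq_integral => t _; rewrite big_ord_recl /tcons tnth0 EFinM.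
    by congr (_ * _%:E); apply: eq_bigr => i _; rewrite tnthS.
  - exact/measurable_EFinP.
  - by move=> t _; rewrite lee_fin.
  - by rewrite lee_fin.
rewrite big_ord_recl EFinM -uc -ge0_integralZr//.
- exact/measurable_EFinP.
- by move=> x _; rewrite lee_fin.
- rewrite lee_fin; apply: prodr_ge0 => i _; rewrite -lee_fin -uc.
  by apply: integral_ge0 => x _; rewrite lee_fin.
Qed.

End tuple_measure.

Section lebesgue_default_display.
Local Open Scope ereal_scope.
Variable R : realType.

Let idR (x : measurableTypeR R) : R := x.

Let measurable_idR : measurable_fun setT idR.
Proof. by move=> _ A mA; rewrite setTI. Qed.

(* [lebesgue_measure] lives on [measurableTypeR R], whose display differs from
   that of the canonical measurable type on [R] used for tuples. *)
Definition leb : set R -> \bar R := pushforward (@lebesgue_measure R) idR.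

Let leb0 : leb set0 = 0. Proof. exact: measure0. Qed.

Let leb_ge0 A : 0 <= leb A. Proof. exact: measure_ge0. Qed.

Let leb_sigma_additive : semi_sigma_additive leb.
Proof. exact: measure_semi_sigma_additive. Qed.

HB.instance Definition _ := isMeasure.Build _ _ _ leb
  leb0 leb_ge0 leb_sigma_additive.

Let sigma_finite_leb : sigma_finite setT leb.
Proof.
apply: (@sigma_finite_pushforward _ _ _ _ _ _ idR (fun x => x)) => //.
exact: sigma_finiteT.
Qed.

HB.instance Definition _ :=
  Measure_isSigmaFinite.Build _ _ _ leb sigma_finite_leb.

Lemma ge0_integral_leb (f : R -> \bar R) :
  measurable_fun setT f -> (forall x, 0 <= f x) ->
  \int[leb]_x f x = \int[@lebesgue_measure R]_x f x.
Proof. by move=> mf f0; rewrite (ge0_integral_pushforward measurable_idR). Qed.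

Lemma integral_leb (f : R -> \bar R) : leb.-integrable setT f ->
  \int[leb]_x f x = \int[@lebesgue_measure R]_x f x.
Proof.
move=> lf; have mf := measurable_int _ lf.
rewrite (integral_pushforward measurable_idR)//.
apply/integrableP; split; first exact: measurableT_comp.
have /integrableP[_] := lf.
by rewrite (ge0_integral_pushforward measurable_idR)//; exact: measurableT_comp.
Qed.

End lebesgue_default_display.

(** * Gaussian densities on tuples *)

Section gaussian_density.
Variable R : realType.
Implicit Types (v a b x y z m th : R) (n : nat).

Definition npdf v m y : R :=
  (Num.sqrt (pi *+ 2 * v))^-1 * expR (- (y - m) ^+ 2 / (v *+ 2)).

Lemma npdf_ge0 v m y : 0 <= npdf v m y.
Proof. by rewrite mulr_ge0 ?expR_ge0 ?invr_ge0 ?sqrtr_ge0. Qed.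

Lemma npdfE v m y : 0 < v -> npdf v m y = normal_pdf m (Num.sqrt v) y.
Proof.
move=> v0; rewrite normal_pdfE ?gt_eqF ?sqrtr_gt0// /npdf /normal_peak /normal_fun.
rewrite sqr_sqrtr ?ltW//; congr ((Num.sqrt _)^-1 * _).
by rewrite mulrC mulrnAr.
Qed.

Lemma measurable_npdf v m : measurable_fun setT (npdf v m).
Proof.
apply: measurable_funM => //; apply: measurableT_comp => //.
apply: measurable_funM => //; apply: measurableT_comp => //.
by apply: measurable_funX; exact: measurable_funB.
Qed.

Lemma integral_npdf v m : 0 < v ->
  (\int[@leb R]_y (npdf v m y)%:E = 1)%E.
Proof.
move=> v0; rewrite ge0_integral_leb; last 2 first.
- by apply/measurable_EFinP; exact: measurable_npdf.
- by move=> x; rewrite lee_fin npdf_ge0.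
under eq_integral do rewrite npdfE//.
exact: integral_normal_pdf.
Qed.

(** Completing the square in [z]. This is Bayes' rule for Gaussians: the marginal of [y] times the
    posterior of [z] given [y], so integrating out [z] leaves the marginal. *)
Lemma npdf_conv a b x y z : 0 < a -> 0 < b ->
  npdf a x z * npdf b z y =
  npdf (a + b) x y * npdf (a * b / (a + b)) ((b * x + a * y) / (a + b)) z.
Proof.
move=> a0 b0; have ab0 : 0 < a + b by exact: addr_gt0.
have p0 : 0 < pi *+ 2 :> R by rewrite pmulrn_lgt0// pi_gt0.
rewrite /npdf mulrACA [RHS]mulrACA -!expRD -!invfM -!sqrtrM ?mulr_ge0 ?ltW//.
congr ((Num.sqrt _)^-1 * expR _); first by field; rewrite gt_eqF.
by field; rewrite !gt_eqF.
Qed.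

(** Completing the square in [y]: the tilt multiplies the precision by [1 - 2 th v], and the result
    is a Gaussian up to a constant while this factor is positive. Both signs of [th] are used
    later. *)
Lemma npdf_tilt v th x x' y : 0 < v -> 0 < 1 - th * v *+ 2 ->
  expR (th * (y - x') ^+ 2) * npdf v x y =
  (Num.sqrt (1 - th * v *+ 2))^-1 *
  expR (th * (x - x') ^+ 2 / (1 - th * v *+ 2)) *
  npdf (v / (1 - th * v *+ 2))
    ((x - th * v *+ 2 * x') / (1 - th * v *+ 2)) y.
Proof.
move=> v0; set k := 1 - _ => k0.
have p0 : 0 < pi *+ 2 :> R by rewrite pmulrn_lgt0// pi_gt0.
rewrite /npdf mulrCA -expRD [RHS]mulrACA -expRD -invfM -sqrtrM ?ltW//.
congr ((Num.sqrt _)^-1 * expR _); first by field; rewrite gt_eqF.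
have -> : th * v *+ 2 = 1 - k by rewrite /k; ring.
have -> : th = (1 - k) / (v *+ 2) by rewrite /k; field; rewrite gt_eqF.
by field; rewrite !gt_eqF.
Qed.

Definition sqn n (y : n.-tuple R) : R := \sum_(i < n) tnth y i ^+ 2.

Lemma sqn_ge0 n (y : n.-tuple R) : 0 <= sqn y.
Proof. by apply: sumr_ge0 => i _; exact: sqr_ge0. Qed.

Lemma enorm_sqr n (y : n.-tuple R) : enorm y ^+ 2 = sqn y.
Proof. by rewrite /enorm sqr_sqrtr// sqn_ge0. Qed.

Lemma tnth_tsub n (y x : n.-tuple R) i : tnth (tsub y x) i = tnth y i - tnth x i.
Proof. by rewrite tnth_mktuple. Qed.

Lemma sqn_tsubv n (x : n.-tuple R) : sqn (tsub x x) = 0.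
Proof. by rewrite /sqn big1// => i _; rewrite tnth_tsub subrr expr0n. Qed.

Definition tzero n : n.-tuple R := [tuple 0 | i < n].

Lemma tsub0 n (y : n.-tuple R) : tsub y (tzero n) = y.
Proof. by apply: eq_from_tnth => i; rewrite tnth_tsub tnth_mktuple subr0. Qed.

Lemma gauss_densE n v (z : n.-tuple R) :
  gauss_dens v z = (Num.sqrt (pi *+ 2 * v)) ^- n * expR (- sqn z / (v *+ 2)).
Proof. by rewrite /gauss_dens enorm_sqr. Qed.

Lemma gauss_dens_prod n v (x y : n.-tuple R) :
  gauss_dens v (tsub y x) = \prod_(i < n) npdf v (tnth x i) (tnth y i).
Proof.
rewrite gauss_densE big_split/= prodr_const card_ord exprVn -expR_sum.
congr (_ * expR _); rewrite -sumrN mulr_suml.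
by apply: eq_bigr => i _; rewrite tnth_tsub.
Qed.

Lemma gauss_dens_gt0 n v (z : n.-tuple R) : 0 < v -> 0 < gauss_dens v z.
Proof.
move=> v0; rewrite mulr_gt0 ?expR_gt0// invr_gt0 exprn_gt0// sqrtr_gt0.
by rewrite mulr_gt0// pmulrn_lgt0// pi_gt0.
Qed.

Lemma gauss_dens_ge0 n v (z : n.-tuple R) : 0 <= gauss_dens v z.
Proof. by rewrite mulr_ge0 ?expR_ge0// invr_ge0 exprn_ge0 ?sqrtr_ge0. Qed.

Lemma measurable_sqn d (T : measurableType d) n (f : T -> n.-tuple R) :
  measurable_fun setT f -> measurable_fun setT (fun t => sqn (f t)).
Proof.
move=> mf; apply: measurable_sum => i; apply: measurable_funX.
by apply: (measurableT_comp (measurable_tnth i)).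
Qed.

Lemma measurable_sqn_id n : measurable_fun setT (@sqn n).
Proof. exact: (measurable_sqn (f := id)). Qed.

Lemma measurable_sqn_preimage n (i : interval R) :
  measurable [set x : n.-tuple R | sqn x \in i].
Proof.
by have := @measurable_sqn_id n measurableT [set` i] (measurable_itv i); rewrite setTI.
Qed.

Lemma measurable_tsub d (T : measurableType d) n (f g : T -> n.-tuple R) :
  measurable_fun setT f -> measurable_fun setT g ->
  measurable_fun setT (fun t => tsub (f t) (g t)).
Proof.
move=> mf mg; apply/measurable_fun_tnthP => i.
rewrite (_ : _ \o _ = fun t => tnth (f t) i - tnth (g t) i).
  apply: measurable_funB.
    exact: (measurableT_comp (measurable_tnth i)).
  exact: (measurableT_comp (measurable_tnth i)).
by apply/funext => t /=; rewrite tnth_tsub.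
Qed.

Lemma measurable_gauss_dens d (T : measurableType d) n v (f : T -> n.-tuple R) :
  measurable_fun setT f -> measurable_fun setT (fun t => gauss_dens v (f t)).
Proof.
move=> mf; rewrite (_ : (fun t => _) = fun t =>
    (Num.sqrt (pi *+ 2 * v)) ^- n * expR (- sqn (f t) / (v *+ 2))); last first.
  by apply/funext => t; rewrite gauss_densE.
apply: measurable_funM => //; apply: measurableT_comp => //.
apply: measurable_funM => //; apply: measurableT_comp => //.
exact: measurable_sqn.
Qed.

Definition lebn n := tmeas (@leb R) n.

Lemma integral_lebn_prod n (u : 'I_n -> R -> R) (c : 'I_n -> R) :
  (forall i, measurable_fun setT (u i)) -> (forall i x, 0 <= u i x) ->
  (forall i, \int[@leb R]_x (u i x)%:E = (c i)%:E)%E ->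
  (\int[lebn n]_t (\prod_(i < n) u i (tnth t i))%:E = (\prod_(i < n) c i)%:E)%E.
Proof.
move=> mu u0 uc; apply: integral_tmeas_prod => // i.
Qed.

Lemma integral_gauss n v (x : n.-tuple R) : 0 < v ->
  (\int[lebn n]_y (gauss_dens v (tsub y x))%:E = 1)%E.
Proof.
move=> v0; under eq_integral do rewrite gauss_dens_prod.
rewrite (@integral_lebn_prod _ (fun i => npdf v (tnth x i)) (fun=> 1)).
- by rewrite big1.
- by move=> i; exact: measurable_npdf.
- by move=> i z; exact: npdf_ge0.
- by move=> i; rewrite integral_npdf.
Qed.

Lemma integral_gauss0 n v : 0 < v ->
  (\int[lebn n]_y (gauss_dens v y)%:E = 1)%E.
Proof.
move=> v0; rewrite -(integral_gauss (tzero n) v0).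
by apply: eq_integral => y _; rewrite tsub0.
Qed.

Lemma gauss_conv n a b (x y : n.-tuple R) : 0 < a -> 0 < b ->
  (\int[lebn n]_z (gauss_dens a (tsub z x) * gauss_dens b (tsub y z))%:E =
   (gauss_dens (a + b) (tsub y x))%:E)%E.
Proof.
move=> a0 b0; under eq_integral do rewrite !gauss_dens_prod -big_split/=.
rewrite (@integral_lebn_prod _
  (fun i z => npdf a (tnth x i) z * npdf b z (tnth y i))
  (fun i => npdf (a + b) (tnth x i) (tnth y i))).
- by rewrite gauss_dens_prod.
- move=> i; under eq_fun do rewrite npdf_conv//.
  by apply: measurable_funM => //; exact: measurable_npdf.
- by move=> i z; rewrite mulr_ge0 ?npdf_ge0.
- move=> i; under eq_integral do rewrite npdf_conv// EFinM.
  rewrite ge0_integralZl ?lee_fin ?npdf_ge0//.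
  + by rewrite integral_npdf ?mule1// divr_gt0 ?mulr_gt0 ?addr_gt0.
  + by apply/measurable_EFinP; exact: measurable_npdf.
  + by move=> z _; rewrite lee_fin npdf_ge0.
Qed.

(** This is the moment generating function of a scaled noncentral chi-square law. *)
Lemma gauss_tilt n v th (x x' : n.-tuple R) : 0 < v -> 0 < 1 - th * v *+ 2 ->
  (\int[lebn n]_y (expR (th * sqn (tsub y x')) * gauss_dens v (tsub y x))%:E =
   ((Num.sqrt (1 - th * v *+ 2)) ^- n *
    expR (th * sqn (tsub x x') / (1 - th * v *+ 2)))%:E)%E.
Proof.
move=> v0; set k := 1 - _ => k0.
have E (y : n.-tuple R) : expR (th * sqn (tsub y x')) * gauss_dens v (tsub y x) =
    \prod_(i < n) (expR (th * (tnth y i - tnth x' i) ^+ 2) *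
                   npdf v (tnth x i) (tnth y i)).
  rewrite gauss_dens_prod [RHS]big_split/=; congr (_ * _).
  rewrite -expR_sum /sqn mulr_sumr; congr expR.
  by apply: eq_bigr => i _; rewrite tnth_tsub.
under eq_integral do rewrite E.
rewrite (@integral_lebn_prod _
  (fun i y => expR (th * (y - tnth x' i) ^+ 2) * npdf v (tnth x i) y)
  (fun i => (Num.sqrt k)^-1 * expR (th * (tnth x i - tnth x' i) ^+ 2 / k))).
- rewrite big_split/= prodr_const card_ord exprVn -expR_sum /sqn.
  congr (_ * expR _)%:E; rewrite mulr_sumr mulr_suml.
  by apply: eq_bigr => i _; rewrite tnth_tsub.
- move=> i; under eq_fun do rewrite npdf_tilt//.
  by apply: measurable_funM => //; exact: measurable_npdf.
- by move=> i z; rewrite mulr_ge0 ?npdf_ge0 ?expR_ge0.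
- move=> i; under eq_integral do rewrite npdf_tilt// EFinM.
  have c0 : 0 <= (Num.sqrt k)^-1 * expR (th * (tnth x i - tnth x' i) ^+ 2 / k).
    by rewrite mulr_ge0 ?expR_ge0// invr_ge0 sqrtr_ge0.
  rewrite ge0_integralZl ?lee_fin//.
  + by rewrite integral_npdf ?mule1// divr_gt0.
  + by apply/measurable_EFinP; exact: measurable_npdf.
  + by move=> z _; rewrite lee_fin npdf_ge0.
Qed.

End gaussian_density.

(** * Second moments of Gaussian vectors, from exponential moments *)

Section gaussian_moment.
Variable R : realType.
Implicit Types (v a b m th : R) (n : nat).

Lemma le_lin_eps (a b C t0 : R) : 0 < t0 -> 0 <= C ->
  (forall t, 0 < t -> t < t0 -> a <= b + t * C) -> a <= b.
Proof.
move=> t00 C0 H; apply/ler_addgt0Pr => e e0.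
pose t := Num.min (t0 / 2) (e / (C + 1)).
have C1 : 0 < C + 1 by lra.
have t_gt0 : 0 < t by rewrite lt_min !divr_gt0.
apply: (le_trans (H t t_gt0 _)).
  by rewrite /t (@le_lt_trans _ _ (t0 / 2)) ?ge_min ?lexx//; lra.
rewrite lerD2l; apply: (@le_trans _ _ (e / (C + 1) * (C + 1))); last by rewrite divfK ?gt_eqF.
apply: ler_pM => //; [exact: ltW| |lra].
by rewrite /t ge_min lexx orbT.
Qed.

Lemma squeeze_slope (M s w : R) : 0 <= M -> 0 <= s -> 0 < w ->
  (forall t, 0 < t -> 0 < 1 - t * w -> 1 + t * M <= expR (t * s / (1 - t * w))) ->
  (forall t, 0 < t -> 1 <= expR (- (t * s / (1 + t * w))) + t * M) ->
  M = s.
Proof.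
move=> M0 s0 w0 up lo.
have sw0 : 0 < s + w by rewrite ltr_wpDl.
have t00 : 0 < (s + w)^-1 by rewrite invr_gt0.
have C0 : 0 <= M * (s + w) by rewrite mulr_ge0// (ltW sw0).
apply/eqP; rewrite eq_le; apply/andP; split.
- apply: (@le_lin_eps _ _ (M * (s + w)) _ t00) => // t t0 tlt.
  have ts : t * (s + w) < 1 by rewrite -ltr_pdivlMr// div1r.
  have tsw : t * (s + w) = t * s + t * w by ring.
  have ts0 : 0 <= t * s by rewrite mulr_ge0// (ltW t0).
  have k0 : 0 < 1 - t * w by lra.
  have := up _ t0 k0; set X := t * s / _ => UX.
  have X1 : X * (1 - t * w) = t * s by rewrite /X divfK ?gt_eqF.
  have Xlt : X < 1 by rewrite /X ltr_pdivrMr// mul1r; lra.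
  have := expR_ge1Dx (- X); rewrite expRN => E1.
  have eX : 0 < expR X by exact: expR_gt0.
  have E2 : (1 - X) * expR X <= 1.
    by rewrite -ler_pdivlMr// div1r.
  have E3 : (1 + t * M) * (1 - X) <= 1.
    by apply: le_trans E2; rewrite mulrC ler_wpM2l// subr_ge0 (ltW Xlt).
  have E4 : t * M <= X * (1 + t * M) by lra.
  have E5 : t * M * (1 - t * w) <= t * s * (1 + t * M).
    by have := ler_wpM2r (ltW k0) E4; rewrite [leRHS]mulrAC X1.
  by rewrite -(@ler_pM2l _ t)//; lra.
- apply: (@le_lin_eps _ _ (M * (s + w)) _ t00) => // t t0 tlt.
  have tw0 : 0 < t * w by exact: mulr_gt0.
  have k0 : 0 < 1 + t * w by lra.
  have := lo _ t0; set X := t * s / _ => UX.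
  have X1 : X * (1 + t * w) = t * s by rewrite /X divfK ?gt_eqF.
  have X0 : 0 <= X by rewrite /X divr_ge0 ?mulr_ge0 ?(ltW t0) ?(ltW k0).
  have E1 := expR_ge1Dx X.
  have eX : 0 < expR X by exact: expR_gt0.
  have E2 : expR (- X) * (1 + X) <= 1.
    by rewrite expRN mulrC ler_pdivrMr// mul1r.
  have E3 : 1 * (1 + X) <= (expR (- X) + t * M) * (1 + X).
    by rewrite ler_wpM2r//; lra.
  have E4 : X <= t * M * (1 + X) by lra.
  have E5 : t * s <= t * M * (1 + t * w + t * s).
    have E6 : t * M * (1 + X) * (1 + t * w) = t * M * (1 + t * w + t * s).
      by rewrite -X1; ring.
    by have := ler_wpM2r (ltW k0) E4; rewrite X1 E6.
  by rewrite -(@ler_pM2l _ t)//; lra.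
Qed.

(** With [k = 1 - 2 th v] one has [1 / k = 1 + 2 th v / k <= expR (2 th v / k)]. The prefactor is
    thus absorbed in the exponential, whose slope at [th = 0] becomes the expected moment [d + n v],
    for either sign of [th]. *)
Lemma tilt_le n v th (d : R) : 0 < v -> 0 < 1 - th * v *+ 2 ->
  (Num.sqrt (1 - th * v *+ 2)) ^- n * expR (th * d / (1 - th * v *+ 2)) <=
  expR (th * (d + n%:R * v) / (1 - th * v *+ 2)).
Proof.
move=> v0; set k := 1 - _ => k0.
have -> : th * (d + n%:R * v) / k = n%:R * (th * v / k) + th * d / k by ring.
rewrite expRD ler_pM2r ?expR_gt0// expRM_natl -exprVn.
apply: lerXn2r; rewrite ?nnegrE ?expR_ge0 ?invr_ge0 ?sqrtr_ge0//.
rewrite -(@ler_pXn2r _ 2) ?nnegrE ?expR_ge0 ?invr_ge0 ?sqrtr_ge0//.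
rewrite exprVn sqr_sqrtr ?(ltW k0)// -expRM_natl.
apply: le_trans (expR_ge1Dx _).
have -> : th * v = (1 - k) / 2 by rewrite /k; field.
move: k k0 => k k0; rewrite [leLHS](_ : _ = 1 + 2 * ((1 - k) / 2 / k))//.
by field; rewrite gt_eqF.
Qed.

(* [M = s] is read off the slope at [th = 0] of the exponential moment
   [gauss_tilt], by squeezing from both signs of [th]. *)
Lemma gauss_moment n v (x x' : n.-tuple R) : 0 < v ->
  (\int[lebn R n]_y (sqn (tsub y x') * gauss_dens v (tsub y x))%:E =
   (sqn (tsub x x') + n%:R * v)%:E)%E.
Proof.
move=> v0; set m := (LHS); set d := sqn (tsub x x'); set s := d + n%:R * v.
have s0 : 0 <= s by rewrite addr_ge0 ?sqn_ge0// mulr_ge0// (ltW v0).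
have mq : measurable_fun setT (fun y : n.-tuple R => sqn (tsub y x')).
  exact/measurable_sqn/measurable_tsub.
have mg : measurable_fun setT (fun y : n.-tuple R => gauss_dens v (tsub y x)).
  exact/measurable_gauss_dens/measurable_tsub.
have me th : measurable_fun setT
    (fun y : n.-tuple R => expR (th * sqn (tsub y x')) * gauss_dens v (tsub y x)).
  apply: measurable_funM => //; apply: measurableT_comp => //.
  exact: measurable_funM.
have m0 : (0 <= m)%E.
  by apply: integral_ge0 => y _; rewrite lee_fin mulr_ge0 ?sqn_ge0 ?gauss_dens_ge0.
have thm th : 0 <= th -> (th%:E * m)%E =
    (\int[lebn R n]_y (th * (sqn (tsub y x') * gauss_dens v (tsub y x)))%:E)%E.
  move=> th0; under [RHS]eq_integral do rewrite EFinM.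
  rewrite ge0_integralZl ?lee_fin//.
    exact/measurable_EFinP/measurable_funM.
  by move=> y _; rewrite lee_fin mulr_ge0 ?sqn_ge0 ?gauss_dens_ge0.
have up th : 0 < th -> 0 < 1 - th * v *+ 2 ->
    (1 + th%:E * m <= (expR (th * s / (1 - th * v *+ 2)))%:E)%E.
  move=> th0 k0; rewrite thm ?(ltW th0)// -(integral_gauss x v0) -ge0_integralD//.
  - apply: (@le_trans _ _ (\int[lebn R n]_y
      (expR (th * sqn (tsub y x')) * gauss_dens v (tsub y x))%:E)%E).
      apply: ge0_le_integral => //.
      + by move=> y _; rewrite adde_ge0 ?lee_fin ?mulr_ge0 ?sqn_ge0 ?gauss_dens_ge0 ?(ltW th0).
      + apply: emeasurable_funD; apply/measurable_EFinP => //.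
        by apply: measurable_funM => //; exact: measurable_funM.
      + exact/measurable_EFinP.
      + move=> y _; rewrite -EFinD lee_fin mulrA -{1}[gauss_dens _ _]mul1r -mulrDl.
        by rewrite ler_wpM2r ?gauss_dens_ge0// expR_ge1Dx.
    by rewrite gauss_tilt// lee_fin tilt_le.
  - by move=> y _; rewrite lee_fin gauss_dens_ge0.
  - exact/measurable_EFinP.
  - by move=> y _; rewrite lee_fin !mulr_ge0 ?sqn_ge0 ?gauss_dens_ge0 ?(ltW th0).
  - apply/measurable_EFinP.
    by apply: measurable_funM => //; exact: measurable_funM.
have lo th : 0 < th ->
    (1 <= (expR (- (th * s / (1 + th * v *+ 2))))%:E + th%:E * m)%E.
  move=> th0; have k0 : 0 < 1 - - th * v *+ 2.
    by rewrite mulNr mulNrn opprK ltr_pwDl// mulrn_wge0// mulr_ge0 ?(ltW th0) ?(ltW v0).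
  have tl := tilt_le n d v0 k0.
  apply: (@le_trans _ _ (((Num.sqrt (1 - - th * v *+ 2)) ^- n *
    expR (- th * d / (1 - - th * v *+ 2)))%:E + th%:E * m)%E); last first.
    rewrite leeD2r// lee_fin (le_trans tl)//.
    by rewrite !mulNr mulNrn opprK.
  rewrite -gauss_tilt// thm ?(ltW th0)// -(integral_gauss x v0) -ge0_integralD//.
  - apply: ge0_le_integral => //.
    + by move=> y _; rewrite lee_fin gauss_dens_ge0.
    + exact/measurable_EFinP.
    + apply: emeasurable_funD; apply/measurable_EFinP => //.
      by apply: measurable_funM => //; exact: measurable_funM.
    + move=> y _; rewrite -EFinD lee_fin mulrA -mulrDl.
      rewrite ler_peMl ?gauss_dens_ge0//.
      have := expR_ge1Dx (- th * sqn (tsub y x')); lra.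
  - by move=> y _; rewrite lee_fin mulr_ge0 ?expR_ge0 ?gauss_dens_ge0.
  - exact/measurable_EFinP.
  - by move=> y _; rewrite lee_fin !mulr_ge0 ?sqn_ge0 ?gauss_dens_ge0 ?(ltW th0).
  - apply/measurable_EFinP.
    by apply: measurable_funM => //; exact: measurable_funM.
(* The upper bound at [th = 1 / (4 v)], where [1 - 2 th v = 1 / 2], excludes an infinite moment. *)
have mfin : m \is a fin_num.
  rewrite ge0_fin_numE// ltNge leye_eq; apply/negP => /eqP moo.
  have th0 : 0 < (v *+ 4)^-1 by rewrite invr_gt0 pmulrn_lgt0.
  have := up _ th0; rewrite moo gt0_muley ?lte_fin// => /(_ _)/wrap[].
    by rewrite (_ : 1 - _ = 2^-1)//; field; rewrite gt_eqF.
  by rewrite addey.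
move: up lo; rewrite -(fineK mfin); set M := fine m => up lo.
have M0 : 0 <= M by rewrite fine_ge0.
congr EFin; apply: (@squeeze_slope M s (v *+ 2)) => //.
- by rewrite pmulrn_lgt0.
- by move=> t t0; rewrite mulrnAr => k0; have := up _ t0 k0; rewrite lee_fin.
- by move=> t t0; rewrite mulrnAr; have := lo _ t0; rewrite lee_fin.
Qed.

End gaussian_moment.

(** * Functions with Gaussian decay and their iterated integrals *)

Section gaussian_domination.
Variable R : realType.
Implicit Types (v a b m th : R) (n : nat).

(** Recentres a Gaussian at the origin at the price of half its decay rate; hence the exponent
    [1 / (4 v)] in the bounds below in place of [1 / (2 v)]. *)
Lemma sqn_tsub_ge n (y x : n.-tuple R) : sqn y / 2 - sqn x <= sqn (tsub y x).
Proof.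
rewrite /sqn mulr_suml -sumrB; apply: ler_sum => i _; rewrite tnth_tsub.
have := sqr_ge0 (tnth y i - 2 * tnth x i); lra.
Qed.

Lemma sqn_tsub_le n (y x : n.-tuple R) :
  sqn (tsub y x) <= 2 * sqn y + 2 * sqn x.
Proof.
rewrite /sqn !mulr_sumr -big_split/=; apply: ler_sum => i _; rewrite tnth_tsub.
have := sqr_ge0 (tnth y i + tnth x i); lra.
Qed.

(* Gaussian domination passes to sections [t |-> h (x :: t)], so that Fubini
   applies at every stage of the iterated integral [int_Rn]. *)
Definition gdom n (h : n.-tuple R -> R) : Prop :=
  measurable_fun setT h /\ exists K a, [/\ 0 <= K, 0 < a &
    forall y, `|h y| <= K * expR (- (a * sqn y))].

Lemma integrable_gauss n v : 0 < v ->
  (lebn R n).-integrable setT (EFin \o gauss_dens v).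
Proof.
move=> v0; have mg : measurable_fun [set: n.-tuple R] (gauss_dens v).
  exact: (measurable_gauss_dens v (f := id)).
apply/integrableP; split; first exact/measurable_EFinP.
under eq_integral do rewrite /= ger0_norm ?gauss_dens_ge0//.
by rewrite integral_gauss0// ltry.
Qed.

Lemma gdom_integrable n (h : n.-tuple R -> R) : gdom h ->
  (lebn R n).-integrable setT (EFin \o h).
Proof.
move=> [mh [K [a [K0 a0 hK]]]].
(* With [1 / (2 v) = a] the dominating function is [K * C] times the Gaussian density of variance
   [v]. *)
pose v := (a *+ 2)^-1; have v0 : 0 < v by rewrite invr_gt0 pmulrn_lgt0.
pose C := (Num.sqrt (pi *+ 2 * v)) ^+ n.
have C0 : C != 0.
  rewrite /C expf_eq0 negb_and; apply/orP; right.
  by rewrite sqrtr_eq0 -ltNge mulr_gt0// pmulrn_lgt0// pi_gt0.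
apply: (@le_integrable _ _ _ _ _ _ _ (fun y => (K * C)%:E * (gauss_dens v y)%:E)%E) => //.
- exact/measurable_EFinP.
- move=> y _; rewrite /= lee_fin (le_trans (hK y))//.
  rewrite -mulrA gauss_densE mulVKf// ger0_norm ?mulr_ge0 ?expR_ge0//.
  by rewrite ler_wpM2l// ler_expR mulNr /v; rewrite (_ : sqn y / _ = a * sqn y)//; field; rewrite gt_eqF.
- by apply: integrableZl => //; exact: integrable_gauss.
Qed.

Lemma EFin_Rintegral n (h : n.-tuple R -> R) : gdom h ->
  (\int[lebn R n]_y (h y)%:E = (\int[lebn R n]_y h y)%R%:E)%E.
Proof.
move=> gh; rewrite /Rintegral fineK//.
by apply: integrable_fin_num => //; exact: gdom_integrable.
Qed.

Lemma gdom_cons n (h : n.+1.-tuple R -> R) (x : R) :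
  gdom h -> gdom (fun t : n.-tuple R => h [tuple of x :: t]).
Proof.
move=> [mh [K [a [K0 a0 hK]]]]; split.
  by apply: (measurableT_comp mh); exact: measurable_cons.
exists (K * expR (- (a * x ^+ 2))), a; split => //.
  by rewrite mulr_ge0 ?expR_ge0.
move=> t; rewrite (le_trans (hK _))// -mulrA -expRD -opprD -mulrDr.
rewrite /sqn big_ord_recl tnth0.
by under eq_bigr do rewrite tnthS.
Qed.

Lemma int_RnE n (h : n.-tuple R -> R) : gdom h ->
  int_Rn (fun y => (h y)%:E) = (\int[lebn R n]_y (h y)%:E)%E.
Proof.
elim: n h => [|n IH] h gh.
  rewrite integral_tmeas0//; apply/measurable_EFinP; exact: (proj1 gh).
have ih := gdom_integrable gh.
rewrite integral_tmeasS// integral_leb; last first.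
  exact: (integrable_fubini_F (integrable_tcons ih)).
apply: eq_integral => x _; apply: (IH (fun t => h [tuple of x :: t])).
exact: gdom_cons.
Qed.

Lemma gdomZ n (c : R) (h : n.-tuple R -> R) :
  gdom h -> gdom (fun y => c * h y).
Proof.
move=> [mh [K [a [K0 a0 hK]]]]; split; first exact: measurable_funM.
exists (`|c| * K), a; split => //; first by rewrite mulr_ge0.
by move=> y; rewrite normrM -mulrA ler_wpM2l.
Qed.

Lemma gdomD n (h k : n.-tuple R -> R) :
  gdom h -> gdom k -> gdom (fun y => h y + k y).
Proof.
move=> [mh [K [a [K0 a0 hK]]]] [mk [L [b [L0 b0 kL]]]].
split; first exact: measurable_funD.
exists (K + L), (Num.min a b); split; [exact: addr_ge0|by rewrite lt_min a0|].
move=> y; rewrite (le_trans (ler_normD _ _))// mulrDl lerD//.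
- rewrite (le_trans (hK y))// ler_wpM2l// ler_expR lerN2 ler_wpM2r ?sqn_ge0//.
  by rewrite ge_min lexx.
- rewrite (le_trans (kL y))// ler_wpM2l// ler_expR lerN2 ler_wpM2r ?sqn_ge0//.
  by rewrite ge_min lexx orbT.
Qed.

Lemma gdomB n (h k : n.-tuple R -> R) :
  gdom h -> gdom k -> gdom (fun y => h y - k y).
Proof.
move=> gh gk; have := gdomD gh (gdomZ (-1) gk).
by under [X in gdom X -> _]eq_fun do rewrite mulN1r.
Qed.

(** Half of the decay of [w] is spent on the quadratic factor: with [u = a |y|^2 / 2], both [1] and
    [u] are at most [expR u]. This admits products of densities with squared norms and with
    log-ratios. *)
Lemma gdomM n (w phi : n.-tuple R -> R) (A B : R) : 0 <= A -> 0 <= B ->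
  gdom w -> measurable_fun setT phi -> (forall y, `|phi y| <= A + B * sqn y) ->
  gdom (fun y => w y * phi y).
Proof.
move=> A0 B0 [mw [K [a [K0 a0 hK]]]] mphi hphi.
split; first exact: measurable_funM.
have a2 : 0 < a / 2 by rewrite divr_gt0.
exists (K * (A + B / (a / 2))), (a / 2); split => //.
  by rewrite mulr_ge0// addr_ge0// divr_ge0// (ltW a2).
move=> y; rewrite normrM.
apply: (@le_trans _ _ (K * expR (- (a * sqn y)) * (A + B * sqn y))).
  by apply: ler_pM.
have -> : expR (- (a * sqn y)) = expR (- (a / 2 * sqn y)) * expR (- (a / 2 * sqn y)).
  by rewrite -expRD; congr expR; field.
set u := a / 2 * sqn y.
rewrite -[leLHS]mulrA -[leRHS]mulrA ler_wpM2l// [leRHS]mulrC -mulrA.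
rewrite ler_wpM2l ?expR_ge0//.
have u0 : 0 <= u by rewrite mulr_ge0 ?sqn_ge0// (ltW a2).
have -> : B * sqn y = B / (a / 2) * u.
  by rewrite /u mulrA divfK// gt_eqF.
have c0 : 0 <= B / (a / 2) by rewrite divr_ge0// (ltW a2).
have e1 : 0 < expR u by exact: expR_gt0.
have e2 := expR_ge1Dx u.
rewrite expRN ler_pdivrMl// mulrDr lerD//.
- by rewrite ler_peMl//; lra.
- by rewrite [leRHS]mulrC ler_wpM2l//; lra.
Qed.

Lemma gdom_gauss n v (x : n.-tuple R) : 0 < v ->
  gdom (fun y => gauss_dens v (tsub y x)).
Proof.
move=> v0; split; first exact/measurable_gauss_dens/measurable_tsub.
exists ((Num.sqrt (pi *+ 2 * v)) ^- n * expR (sqn x / (v *+ 2))), (v *+ 4)^-1.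
have p0 : 0 <= (Num.sqrt (pi *+ 2 * v)) ^- n.
  by rewrite invr_ge0 exprn_ge0// sqrtr_ge0.
split => [||y]; first by rewrite mulr_ge0 ?expR_ge0.
  by rewrite invr_gt0 pmulrn_lgt0.
rewrite ger0_norm ?gauss_dens_ge0// gauss_densE -mulrA ler_wpM2l// -expRD ler_expR.
have -> : sqn x / (v *+ 2) - (v *+ 4)^-1 * sqn y = - (sqn y / 2 - sqn x) / (v *+ 2).
  by field; rewrite gt_eqF.
rewrite ler_wpM2r ?invr_ge0 ?mulrn_wge0 ?(ltW v0)// lerN2.
exact: sqn_tsub_ge.
Qed.

Lemma gdom_gauss0 n v : 0 < v -> gdom (fun y : n.-tuple R => gauss_dens v y).
Proof.
move=> v0; have := gdom_gauss (tzero R n) v0.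
by under [X in gdom X -> _]eq_fun do rewrite tsub0.
Qed.

End gaussian_domination.

(** * Output densities and mutual information *)

Section kernel_fubini.
Context d1 d2 (X : measurableType d1) (Y : measurableType d2) (R : realType).
Variables (mu : {sigma_finite_measure set X -> \bar R}).
Variables (nu : {sigma_finite_measure set Y -> \bar R}).
Variables (h w : X -> R) (k : X * Y -> R).
Hypotheses (mh : measurable_fun setT h) (mk : measurable_fun setT k).
Hypotheses (k0 : forall z, 0 <= k z).
Hypothesis kw : forall x, (\int[nu]_y (k (x, y))%:E = (w x)%:E)%E.
Hypothesis hw : mu.-integrable setT (fun x => (w x * h x)%:E).

Let mkx x : measurable_fun setT (fun y => k (x, y)).
Proof. exact: (measurableT_comp mk (measurable_pair1 x)). Qed.

Let w0 x : 0 <= w x.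
Proof.
by rewrite -lee_fin -kw; apply: integral_ge0 => y _; rewrite lee_fin.
Qed.

(** Integrating the absolute value over [y] first gives [w |h|], so the integrability of [w h]
    suffices although [h] is signed. *)
Lemma integrable_kernel :
  (mu \x nu)%E.-integrable setT (fun z => (k z * h z.1)%:E).
Proof.
apply/integrable12ltyP.
  apply/measurable_EFinP; apply: measurable_funM => //.
  exact: measurableT_comp.
have /integrableP[_] := hw; apply: le_lt_trans.
rewrite le_eqVlt; apply/orP; left; apply/eqP; apply: eq_integral => x _ /=.
rewrite normrM EFinM (ger0_norm (w0 x)) -kw -ge0_integralZr ?lee_fin//.
- by apply: eq_integral => y _; rewrite normrM (ger0_norm (k0 _)) EFinM.
- exact/measurable_EFinP.
- by move=> y _; rewrite lee_fin.
Qed.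

(** Serves twice: with the input law as [nu], to average the log-ratio over the input, and with
    [w = 1], to push it through the additional Gaussian noise. *)
Lemma integral_kernel :
  (\int[nu]_y \int[mu]_x (k (x, y) * h x)%:E = \int[mu]_x (w x * h x)%:E)%E.
Proof.
rewrite -(Fubini integrable_kernel); apply: eq_integral => x _ /=.
under eq_integral do rewrite EFinM.
rewrite integralZr ?kw//; apply/integrableP; split; first exact/measurable_EFinP.
under eq_integral do rewrite /= ger0_norm//.
by rewrite kw ltry.
Qed.

Lemma integrable_kernel_integral :
  nu.-integrable setT (fun y => (\int[mu]_x (k (x, y) * h x)%:E)%E).
Proof.
have iK := (integrable12ltyP mu nu (measurable_int _ integrable_kernel)).1
  integrable_kernel.
pose sw (z : Y * X) := (z.2, z.1).
have msw : measurable_fun setT sw by exact: measurable_fun_pair.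
have mswap : measurable_fun setT (fun z : Y * X => (k (sw z) * h z.2)%:E).
  apply/measurable_EFinP/measurable_funM; last exact: measurableT_comp.
  exact: (measurableT_comp mk msw).
have iS : (nu \x mu)%E.-integrable setT (fun z => (k (sw z) * h z.2)%:E).
  exact/(integrable21ltyP nu mu mswap).
exact: (integrable_fubini_F iS).
Qed.

End kernel_fubini.

Section output_density.
Variables (R : realType) (n : nat) (v rho : R) (P : probability (n.-tuple R) R).
Hypotheses (v0 : 0 < v) (rho0 : 0 <= rho).
Hypothesis Prho : {ae P, forall x, sqn x <= rho}.

Let pk := (Num.sqrt (pi *+ 2 * v)) ^- n.

Let pk0 : 0 < pk.
Proof.
by rewrite invr_gt0 exprn_gt0// sqrtr_gt0 mulr_gt0// pmulrn_lgt0// pi_gt0.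
Qed.

Let mgx y : measurable_fun setT (fun x : n.-tuple R => gauss_dens v (tsub y x)).
Proof. exact/measurable_gauss_dens/measurable_tsub. Qed.

(** The kernel never exceeds its peak [pk], so the [fine] in [out_dens] hides no infinite value. *)
Lemma out_densE y :
  (\int[P]_x (gauss_dens v (tsub y x))%:E = (out_dens v P y)%:E)%E.
Proof.
rewrite /out_dens fineK// ge0_fin_numE; last first.
  by apply: integral_ge0 => x _; rewrite lee_fin gauss_dens_ge0.
apply: (@le_lt_trans _ _ (\int[P]_x pk%:E)%E).
  apply: ge0_le_integral => //.
  - by move=> x _; rewrite lee_fin gauss_dens_ge0.
  - exact/measurable_EFinP.
  - move=> x _; rewrite lee_fin gauss_densE ler_piMr ?(ltW pk0)//.
    rewrite -[leRHS]expR0 ler_expR mulNr oppr_le0 divr_ge0 ?sqn_ge0//.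
    by rewrite mulrn_wge0// (ltW v0).
by rewrite integral_cst// [X in (_ * X)%E]probability_setT mule1 ltry.
Qed.

(** [sqn_tsub_ge] holds uniformly over inputs with [sqn x <= rho], so the bound survives averaging
    over the input; the lower bound uses [sqn_tsub_le] in the same way. *)
Lemma out_dens_le y :
  out_dens v P y <= pk * expR (rho / (v *+ 2) - sqn y / (v *+ 4)).
Proof.
set c := (leRHS); have c0 : 0 <= c by rewrite mulr_ge0 ?expR_ge0 ?(ltW pk0).
rewrite -lee_fin -out_densE.
rewrite -[leRHS]mule1 -(probability_setT P) -integral_cst//.
apply: ae_ge0_le_integral => //.
- by move=> x _; rewrite lee_fin gauss_dens_ge0.
- exact/measurable_EFinP.
- apply: filterS Prho => x xr _; rewrite lee_fin gauss_densE ler_pM2l// ler_expR.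
  have -> : rho / (v *+ 2) - sqn y / (v *+ 4) = - (sqn y / 2 - rho) / (v *+ 2).
    by field; rewrite gt_eqF.
  rewrite ler_wpM2r ?invr_ge0 ?mulrn_wge0 ?(ltW v0)// lerN2.
  by have := sqn_tsub_ge y x; lra.
Qed.

Lemma out_dens_ge y :
  pk * expR (- ((sqn y + rho) / v)) <= out_dens v P y.
Proof.
set c := (leLHS); have c0 : 0 <= c by rewrite mulr_ge0 ?expR_ge0 ?(ltW pk0).
rewrite -lee_fin -out_densE.
rewrite -[leLHS]mule1 -(probability_setT P) -integral_cst//.
apply: ae_ge0_le_integral => //.
- by move=> x _; rewrite lee_fin gauss_dens_ge0.
- exact/measurable_EFinP.
- apply: filterS Prho => x xr _; rewrite lee_fin gauss_densE ler_pM2l// ler_expR.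
  have -> : (sqn y + rho) / v = (2 * sqn y + 2 * rho) / (v *+ 2).
    by field; rewrite gt_eqF.
  rewrite mulNr lerN2 ler_wpM2r ?invr_ge0 ?mulrn_wge0 ?(ltW v0)//.
  by have := sqn_tsub_le y x; lra.
Qed.

Lemma out_dens_gt0 y : 0 < out_dens v P y.
Proof. by apply: lt_le_trans (out_dens_ge y); rewrite mulr_gt0 ?expR_gt0. Qed.

Lemma measurable_out_dens : measurable_fun setT (out_dens v P).
Proof.
pose K (z : n.-tuple R * n.-tuple R) := (gauss_dens v (tsub z.2 z.1))%:E.
have mK : measurable_fun setT K.
  by apply/measurable_EFinP/measurable_gauss_dens; exact: measurable_tsub.
have K0 z : (0 <= K z)%E by rewrite lee_fin gauss_dens_ge0.
have := measurable_fun_fubini_tonelli_G (m1 := P) K mK K0.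
rewrite (_ : fubini_G P K = EFin \o out_dens v P); last first.
  by apply/funext => y; rewrite /fubini_G /= -out_densE.
by move/measurable_EFinP.
Qed.

Lemma gdom_out_dens : gdom (out_dens v P).
Proof.
split; first exact: measurable_out_dens.
exists (pk * expR (rho / (v *+ 2))), (v *+ 4)^-1; split.
- by rewrite mulr_ge0 ?expR_ge0 ?(ltW pk0).
- by rewrite invr_gt0 pmulrn_lgt0.
- move=> y; rewrite ger0_norm ?(ltW (out_dens_gt0 y))//.
  by apply: (le_trans (out_dens_le y)); rewrite -[leRHS]mulrA -expRD (mulrC (v *+ 4)^-1).
Qed.

End output_density.

Section data_processing.
Variables (R : realType) (n : nat) (v b rho : R) (P : probability (n.-tuple R) R).
Hypotheses (v0 : 0 < v) (b0 : 0 < b) (rho0 : 0 <= rho).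
Hypothesis Prho : {ae P, forall x, sqn x <= rho}.

(** Expresses that the noisier channel is a degradation of the other one: Tonelli moves the
    convolution inside the input average, where variances add. *)
Lemma integral_out_dens_conv y :
  (\int[lebn R n]_z (out_dens v P z * gauss_dens b (tsub y z))%:E =
   (out_dens (v + b) P y)%:E)%E.
Proof.
pose K (z : n.-tuple R * n.-tuple R) :=
  (gauss_dens v (tsub z.2 z.1) * gauss_dens b (tsub y z.2))%:E.
have mK : measurable_fun setT K.
  apply/measurable_EFinP/measurable_funM.
    by apply: measurable_gauss_dens; exact: measurable_tsub.
  by apply: measurable_gauss_dens; exact: measurable_tsub.
have K0 z : (0 <= K z)%E by rewrite lee_fin mulr_ge0 ?gauss_dens_ge0.
rewrite -out_densE ?addr_gt0//.
transitivity (\int[P]_x \int[lebn R n]_z K (x, z))%E; last first.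
  by apply: eq_integral => x _; rewrite /K gauss_conv.
rewrite (fubini_tonelli (m1 := P) (m2 := lebn R n) K mK K0).
apply: eq_integral => z _; rewrite /K /= EFinM -out_densE//.
rewrite -ge0_integralZr//.
- exact/measurable_EFinP/measurable_gauss_dens/measurable_tsub.
- by move=> x _; rewrite lee_fin gauss_dens_ge0.
- by rewrite lee_fin gauss_dens_ge0.
Qed.

End data_processing.

Section gdom_integral.
Variables (R : realType) (n : nat).
Implicit Types h k : n.-tuple R -> R.

Lemma gdom_RintegralD h k : gdom h -> gdom k ->
  \int[lebn R n]_y (h y + k y) = \int[lebn R n]_y h y + \int[lebn R n]_y k y.
Proof. by move=> gh gk; rewrite RintegralD//; exact: gdom_integrable. Qed.

Lemma gdom_RintegralB h k : gdom h -> gdom k ->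
  \int[lebn R n]_y (h y - k y) = \int[lebn R n]_y h y - \int[lebn R n]_y k y.
Proof. by move=> gh gk; rewrite RintegralB//; exact: gdom_integrable. Qed.

Lemma gdom_RintegralZ c h : gdom h ->
  \int[lebn R n]_y (c * h y) = c * \int[lebn R n]_y h y.
Proof. by move=> gh; rewrite RintegralZl//; exact: gdom_integrable. Qed.

Lemma le_gdom_Rintegral h k : gdom h -> gdom k -> (forall y, h y <= k y) ->
  \int[lebn R n]_y h y <= \int[lebn R n]_y k y.
Proof. by move=> gh gk hk; apply: le_Rintegral => //; exact: gdom_integrable. Qed.

Lemma Rintegral_gauss v (x : n.-tuple R) : 0 < v ->
  \int[lebn R n]_y gauss_dens v (tsub y x) = 1.
Proof. by move=> v0; rewrite /Rintegral integral_gauss. Qed.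

Lemma Rintegral_gauss0 v : 0 < v -> \int[lebn R n]_y gauss_dens v y = 1.
Proof. by move=> v0; rewrite /Rintegral integral_gauss0. Qed.

Lemma Rintegral_gauss_moment v (x x' : n.-tuple R) : 0 < v ->
  \int[lebn R n]_y (gauss_dens v (tsub y x) * sqn (tsub y x')) =
  sqn (tsub x x') + n%:R * v.
Proof.
move=> v0; rewrite /Rintegral; under eq_integral do rewrite mulrC.
by rewrite gauss_moment.
Qed.

End gdom_integral.

(** * Relative entropy of the output with respect to a centred Gaussian *)

Section divergence.
Variables (R : realType) (n : nat) (v w rho : R) (P : probability (n.-tuple R) R).
Hypotheses (v0 : 0 < v) (w0 : 0 < w) (rho0 : 0 <= rho).
Hypothesis Prho : {ae P, forall x, sqn x <= rho}.

Let f := out_dens v P.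
Let f0 y : 0 < f y. Proof. exact: (out_dens_gt0 v0 Prho). Qed.
Let gf : gdom f. Proof. exact: (gdom_out_dens v0 Prho). Qed.

Definition logratio (y : n.-tuple R) : R := ln (out_dens v P y / gauss_dens w y).

Definition peak (a : R) : R := (Num.sqrt (pi *+ 2 * a)) ^- n.

Lemma peak_gt0 a : 0 < a -> 0 < peak a.
Proof.
move=> a0.
by rewrite invr_gt0 exprn_gt0// sqrtr_gt0 mulr_gt0// pmulrn_lgt0// pi_gt0.
Qed.

Lemma ln_gauss_dens a (z : n.-tuple R) : 0 < a ->
  ln (gauss_dens a z) = ln (peak a) - sqn z / (a *+ 2).
Proof.
move=> a0; rewrite gauss_densE -/(peak a) lnM ?posrE ?peak_gt0 ?expR_gt0//.
by rewrite expRK mulNr.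
Qed.

Lemma ln_peak : ln (peak v) - ln (peak w) = n%:R / 2 * ln (w / v).
Proof.
have p0 : 0 < pi *+ 2 :> R by rewrite pmulrn_lgt0// pi_gt0.
have lnp a : 0 < a -> ln (peak a) = - (n%:R / 2 * (ln (pi *+ 2) + ln a)).
  move=> a0; have pa0 : 0 < pi *+ 2 * a by exact: mulr_gt0.
  rewrite /peak lnV ?posrE ?exprn_gt0 ?sqrtr_gt0// lnXn ?sqrtr_gt0//.
  rewrite -lnM ?posrE// -[in RHS](@sqr_sqrtr _ (pi *+ 2 * a)) ?(ltW pa0)//.
  by rewrite lnXn ?sqrtr_gt0// -[_ *+ n]mulr_natl; field.
by rewrite !lnp// ln_div ?posrE//; ring.
Qed.

Lemma logratioE y :
  logratio y = ln (f y) - (ln (peak w) - sqn y / (w *+ 2)).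
Proof.
by rewrite /logratio ln_div ?posrE ?f0 ?gauss_dens_gt0// ln_gauss_dens.
Qed.

Lemma measurable_logratio : measurable_fun setT logratio.
Proof.
rewrite (_ : logratio = fun y =>
    ln (f y) - (ln (peak w) - sqn y / (w *+ 2))); last first.
  by apply/funext => y; exact: logratioE.
have mq := @measurable_sqn_id R n.
apply: measurable_funB.
  by apply: measurableT_comp; [exact: measurable_ln|exact: (proj1 gf)].
by apply: measurable_funB => //; exact: measurable_funM.
Qed.

(** The coefficient [1 / v] comes from the lower Gaussian bound on the output density, and
    [1 / (2 w)] from the reference density. *)
Lemma logratio_bound : exists A B, [/\ 0 <= A, 0 <= B &
  forall y, `|logratio y| <= A + B * sqn y].
Proof.
exists (`|ln (peak v)| + `|ln (peak w)| + rho / v), (v^-1 + (w *+ 2)^-1).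
have vi0 : 0 <= v^-1 by rewrite invr_ge0 (ltW v0).
have wi0 : 0 <= (w *+ 2)^-1 by rewrite invr_ge0 mulrn_wge0// (ltW w0).
have rv0 : 0 <= rho / v by exact: mulr_ge0.
split=> [||y]; [by rewrite !addr_ge0|exact: addr_ge0|].
have qy := sqn_ge0 y.
have U : ln (f y) <= ln (peak v) + rho / v.
  apply: (@le_trans _ _ (ln (peak v * expR (rho / (v *+ 2) - sqn y / (v *+ 4))))).
    rewrite ler_ln ?posrE ?f0 ?mulr_gt0 ?expR_gt0 ?peak_gt0//.
    exact: (out_dens_le v0 Prho).
  rewrite lnM ?posrE ?expR_gt0 ?peak_gt0// expRK lerD2l.
  rewrite (_ : rho / (v *+ 2) = rho / v / 2); last by field; rewrite gt_eqF.
  have : 0 <= sqn y / (v *+ 4) by rewrite divr_ge0 ?mulrn_wge0 ?(ltW v0).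
  lra.
have L : ln (peak v) - (v^-1 * sqn y + rho / v) <= ln (f y).
  apply: (@le_trans _ _ (ln (peak v * expR (- ((sqn y + rho) / v))))); last first.
    rewrite ler_ln ?posrE ?f0 ?mulr_gt0 ?expR_gt0 ?peak_gt0//.
    exact: (out_dens_ge v0 Prho).
  rewrite lnM ?posrE ?expR_gt0 ?peak_gt0// expRK lerD2l lerN2.
  by rewrite mulrDl [v^-1 * _]mulrC.
have qw : 0 <= (w *+ 2)^-1 * sqn y by exact: mulr_ge0.
have qv : 0 <= v^-1 * sqn y by exact: mulr_ge0.
have := ler_norm (ln (peak v)); have := ler_norm (- ln (peak v)).
have := ler_norm (ln (peak w)); have := ler_norm (- ln (peak w)).
rewrite !normrN logratioE [sqn y / _]mulrC mulrDl => *.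
by rewrite ler_norml; apply/andP; split; lra.
Qed.

Lemma gdomM_logratio g : gdom g -> gdom (fun y => g y * logratio y).
Proof.
move=> gg; have [A [B [A0 B0 AB]]] := logratio_bound.
by apply: (gdomM A0 B0) => //; exact: measurable_logratio.
Qed.

Definition kl : R := \int[lebn R n]_y (f y * logratio y).

Lemma Rintegral_out_dens : \int[lebn R n]_y f y = 1.
Proof.
rewrite /Rintegral (_ : (\int[_]_y _)%E = 1%E)//.
pose K (z : n.-tuple R * n.-tuple R) := (gauss_dens v (tsub z.2 z.1))%:E.
have mK : measurable_fun setT K.
  by apply/measurable_EFinP/measurable_gauss_dens; exact: measurable_tsub.
have K0 z : (0 <= K z)%E by rewrite lee_fin gauss_dens_ge0.
transitivity (\int[lebn R n]_y \int[P]_x K (x, y))%E.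
  by apply: eq_integral => y _; rewrite /K out_densE.
rewrite -(fubini_tonelli (m1 := P) (m2 := lebn R n) K mK K0).
under eq_integral do rewrite /K /= integral_gauss//.
by rewrite integral_cst// mul1e; exact: probability_setT.
Qed.

Let gw : gdom (fun y : n.-tuple R => gauss_dens w y).
Proof. exact: gdom_gauss0. Qed.

(** Gibbs' inequality in pointwise form: [ln (1 + z) <= z] at [z = g / f - 1] gives
    [f ln (f / g) >= f - g], and both densities have mass one. *)
Lemma kl_ge0 : 0 <= kl.
Proof.
have -> : 0 = \int[lebn R n]_y (f y - gauss_dens w y).
  by rewrite gdom_RintegralB// Rintegral_out_dens Rintegral_gauss0// subrr.
apply: le_gdom_Rintegral => [||y]; [exact: gdomB|exact: gdomM_logratio|].
rewrite /logratio -/f; set g := gauss_dens w y.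
have g0 : 0 < g by exact: gauss_dens_gt0.
have := @le_ln1Dx _ (g / f y - 1).
rewrite addrCA subrr addr0 => /(_ _)/wrap[].
  by rewrite -subr_gt0 opprK subrK divr_gt0.
rewrite -[f y / g]invf_div lnV ?posrE ?divr_gt0// => H.
have := ler_wpM2l (ltW (f0 y)) H.
by rewrite mulrBr mulrCA divff ?gt_eqF// !mulr1 mulrN; lra.
Qed.

Lemma kl_le M : 0 < M -> (forall y, f y <= M * gauss_dens w y) -> kl <= ln M.
Proof.
move=> M0 fM.
have -> : ln M = \int[lebn R n]_y (ln M * f y).
  by rewrite gdom_RintegralZ// Rintegral_out_dens mulr1.
apply: le_gdom_Rintegral => [||y]; [exact: gdomM_logratio|exact: gdomZ|].
rewrite mulrC ler_wpM2r ?(ltW (f0 y))// /logratio ler_ln ?posrE//.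
  by rewrite ler_pdivrMr ?gauss_dens_gt0.
by rewrite divr_gt0 ?gauss_dens_gt0.
Qed.

End divergence.

(** * Closed form of the mutual information *)

Section mutual_information.
Variables (R : realType) (n : nat) (v w rho : R) (P : probability (n.-tuple R) R).
Hypotheses (v0 : 0 < v) (w0 : 0 < w) (rho0 : 0 <= rho).
Hypothesis Prho : {ae P, forall x, sqn x <= rho}.

Let f := out_dens v P.
Let f0 y : 0 < f y. Proof. exact: (out_dens_gt0 v0 Prho). Qed.

Let g x (y : n.-tuple R) := gauss_dens v (tsub y x).
Let gg x : gdom (g x). Proof. exact: gdom_gauss. Qed.
Let l := logratio v w P.

Lemma integrable_sqn : P.-integrable setT (EFin \o @sqn R n).
Proof.
have mq := @measurable_sqn_id R n.
apply/integrableP; split; first exact/measurable_EFinP.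
apply: (@le_lt_trans _ _ (\int[P]_x rho%:E)%E).
  apply: ae_ge0_le_integral => //.
  - by apply: measurableT_comp => //; exact/measurable_EFinP.
  - by apply: filterS Prho => x xr _; rewrite /= lee_fin ger0_norm ?sqn_ge0.
by rewrite integral_cst// [X in (_ * X)%E]probability_setT mule1 ltry.
Qed.

Let k (z : n.-tuple R * n.-tuple R) := gauss_dens v (tsub z.1 z.2).
Let mk : measurable_fun setT k.
Proof. by apply: measurable_gauss_dens; exact: measurable_tsub. Qed.
Let k0 z : 0 <= k z. Proof. exact: gauss_dens_ge0. Qed.
Let kw y : (\int[P]_x (k (y, x))%:E = (f y)%:E)%E.
Proof. exact: out_densE. Qed.
Let ml : measurable_fun setT l. Proof. exact: (measurable_logratio v0 w0 Prho). Qed.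
Let hw : (lebn R n).-integrable setT (fun y => (f y * l y)%:E).
Proof.
apply: gdom_integrable; apply: (gdomM_logratio v0 w0 rho0 Prho).
exact: (gdom_out_dens v0 Prho).
Qed.

Let Psi x := \int[lebn R n]_y (g x y * l y).

Let gl x : gdom (fun y => g x y * l y).
Proof. exact: (gdomM_logratio v0 w0 rho0 Prho). Qed.

Let PsiE : EFin \o Psi =
  fubini_G (lebn R n) (fun z => (k z * l z.1)%:E).
Proof. by apply/funext => x; rewrite /= -EFin_Rintegral. Qed.

Let integrable_Psi : P.-integrable setT (EFin \o Psi).
Proof. by rewrite PsiE; exact: (integrable_kernel_integral ml mk k0 kw hw). Qed.

Let integral_Psi : (\int[P]_x (Psi x)%:E = (kl v w P)%:E)%E.
Proof.
rewrite /kl -EFin_Rintegral; last first.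
  by apply: (gdomM_logratio v0 w0 rho0 Prho); exact: (gdom_out_dens v0 Prho).
rewrite -(integral_kernel ml mk k0 kw hw).
by apply: eq_integral => x _; rewrite -EFin_Rintegral.
Qed.

Let c0 := n%:R / 2 * ln (w / v) : R.

(** Inserts the Gaussian density of variance [w] between numerator and denominator. The ratio of the
    two Gaussians has a quadratic logarithm, whose mean is explicit; the rest is the log-ratio
    [l]. *)
Let log_split x y : g x y * ln (g x y / f y) =
  c0 * g x y - (v *+ 2)^-1 * (g x y * sqn (tsub y x)) +
  ((w *+ 2)^-1 * (g x y * sqn (tsub y (tzero R n))) - g x y * l y).
Proof.
rewrite ln_div ?posrE ?gauss_dens_gt0// ln_gauss_dens// /l.
rewrite (logratioE v0 w0 Prho) -/f /c0 -(ln_peak n v0 w0) tsub0.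
by ring.
Qed.

(** The compensation identity: mutual information is the mean divergence of the conditional output
    laws from any reference law, minus the divergence of the output law from it. The term [- n / 2]
    is the mean of [- |y - x|^2 / (2 v)], and the numerator over [2 w] is the output power. *)
Lemma mutual_infoE :
  mutual_info v P = (c0 - n%:R / 2 + (fine (\int[P]_x (sqn x)%:E)%E +
    n%:R * v) / (w *+ 2) - kl v w P)%:E.
Proof.
have gm x x' : gdom (fun y => g x y * sqn (tsub y x')).
  have q0 := sqn_ge0 x'.
  apply: (@gdomM _ _ _ _ (2 * sqn x') 2) => //; first by rewrite mulr_ge0.
    exact/measurable_sqn/measurable_tsub.
  by move=> y; rewrite ger0_norm ?sqn_ge0// addrC sqn_tsub_le.
rewrite /mutual_info.
have I1 x : \int[lebn R n]_y g x y = 1 by exact: Rintegral_gauss.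
have I2 x x' : \int[lebn R n]_y (g x y * sqn (tsub y x')) =
    sqn (tsub x x') + n%:R * v by exact: Rintegral_gauss_moment.
have E x : int_Rn (fun y => (g x y * ln (g x y / f y))%:E) =
    ((c0 - n%:R / 2 + n%:R * v / (w *+ 2))%:E +
     ((w *+ 2)^-1%:E * (sqn x)%:E - (Psi x)%:E))%E.
  under eq_fun do rewrite log_split.
  have G1 : gdom (fun y => c0 * g x y - (v *+ 2)^-1 * (g x y * sqn (tsub y x))).
    by apply: gdomB; apply: gdomZ.
  have G2 : gdom (fun y =>
      (w *+ 2)^-1 * (g x y * sqn (tsub y (tzero R n))) - g x y * l y).
    by apply: gdomB => //; apply: gdomZ.
  rewrite int_RnE; last exact: gdomD.
  rewrite EFin_Rintegral; last exact: gdomD.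
  rewrite gdom_RintegralD// !gdom_RintegralB//; try exact: gdomZ.
  rewrite (gdom_RintegralZ c0 (gg x)) (gdom_RintegralZ _ (gm x x)).
  rewrite (gdom_RintegralZ _ (gm x (tzero R n))) I1 !I2.
  rewrite sqn_tsubv tsub0 -/(Psi x) -EFinM -EFinB -EFinD; congr EFin.
  by field; rewrite !gt_eqF.
under eq_integral do rewrite E.
have iq := integrable_sqn.
rewrite integralD//; last 2 first.
- exact: finite_measure_integrable_cst.
- by apply: integrableB => //; exact: integrableZl.
rewrite integralB//; last exact: integrableZl.
rewrite integral_cst// [X in (_ * X)%E]probability_setT mule1.
rewrite integralZl// integral_Psi -(fineK (integrable_fin_num _ iq))//.
rewrite -EFinM -EFinB -EFinD; congr EFin; rewrite /=.
set p := fine _.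
by field; rewrite gt_eqF.
Qed.

End mutual_information.

(** * Data processing for the relative entropy *)

Section kl_data_processing.
Variables (R : realType) (n : nat) (v b w rho : R) (P : probability (n.-tuple R) R).
Hypotheses (v0 : 0 < v) (b0 : 0 < b) (w0 : 0 < w) (rho0 : 0 <= rho).
Hypothesis Prho : {ae P, forall x, sqn x <= rho}.

Let f1 := out_dens v P.
Let f2 := out_dens (v + b) P.
Let l1 := logratio v w P.
Let l2 := logratio (v + b) (w + b) P.
Let f10 y : 0 < f1 y. Proof. exact: (out_dens_gt0 v0 Prho). Qed.
Let vb0 : 0 < v + b. Proof. exact: addr_gt0. Qed.
Let f20 y : 0 < f2 y. Proof. exact: (out_dens_gt0 vb0 Prho). Qed.
Let gf1 : gdom f1. Proof. exact: (gdom_out_dens v0 Prho). Qed.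

Let k (z : n.-tuple R * n.-tuple R) := gauss_dens b (tsub z.2 z.1).
Let mk : measurable_fun setT k.
Proof. by apply: measurable_gauss_dens; exact: measurable_tsub. Qed.
Let k0 z : 0 <= k z. Proof. exact: gauss_dens_ge0. Qed.

Let gdom_k (h : n.-tuple R -> R) y : gdom h -> gdom (fun z => h z * k (z, y)).
Proof.
move=> gh; have p0 := ltW (peak_gt0 n b0).
apply: (@gdomM _ _ _ _ (peak n b) 0) => //.
  exact: (measurableT_comp mk (measurable_pair2 y)).
move=> z; rewrite mul0r addr0 ger0_norm ?k0// /k gauss_densE ler_piMr//.
rewrite -[leRHS]expR0 ler_expR mulNr oppr_le0 divr_ge0 ?sqn_ge0//.
by rewrite mulrn_wge0// (ltW b0).
Qed.

Let f2E y : \int[lebn R n]_z (f1 z * k (z, y)) = f2 y.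
Proof. by rewrite /Rintegral (integral_out_dens_conv P v0 b0). Qed.

(** The reference density must pass through the same channel as the output density, which is why its
    variance is shifted by the same [b]. *)
Let gamma2E y : \int[lebn R n]_z (gauss_dens w z * k (z, y)) = gauss_dens (w + b) y.
Proof.
have E := gauss_conv (tzero R n) y w0 b0; rewrite tsub0 in E.
have E' : (\int[lebn R n]_z (gauss_dens w z * k (z, y))%:E =
    (gauss_dens (w + b) y)%:E)%E.
  by apply: etrans E; apply: eq_integral => z _; rewrite tsub0.
by rewrite /Rintegral E'.
Qed.

Let gw : gdom (fun y : n.-tuple R => gauss_dens w y).
Proof. exact: gdom_gauss0. Qed.

(* The log-sum inequality: [a ln (a / (b r)) >= a - b r] with [a = f1 z * k],
   [b = gamma1 z * k] and [r = f2 y / gamma2 y], integrated over [z]. *)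
Let log_sum y : f2 y * l2 y <= \int[lebn R n]_z (k (z, y) * (f1 z * l1 z)).
Proof.
have gf1k := gdom_k y gf1.
have gl1 : gdom (fun z => f1 z * l1 z) by exact: (gdomM_logratio v0 w0 rho0 Prho).
have gl1k := gdom_k y gl1.
pose r := f2 y / gauss_dens (w + b) y.
have wb0 : 0 < gauss_dens (w + b) y by apply: gauss_dens_gt0; exact: addr_gt0.
have r0 : 0 < r by rewrite divr_gt0.
(* The tangent-line form of the left side: the integral is [(l2 y + 1) * f2 y] minus [r] times the
   smoothed reference, and that last product is [f2 y], cancelling the extra 1. *)
have -> : f2 y * l2 y = \int[lebn R n]_z
    ((l2 y + 1) * (f1 z * k (z, y)) - r * (gauss_dens w z * k (z, y))).
  rewrite gdom_RintegralB; [|exact: gdomZ|apply: gdomZ; exact: gdom_k].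
  rewrite !gdom_RintegralZ//; last exact: gdom_k.
  rewrite f2E gamma2E /r divfK ?gt_eqF//; ring.
apply: le_gdom_Rintegral.
- by apply: gdomB; [exact: gdomZ|apply: gdomZ; exact: gdom_k].
- by under eq_fun do rewrite mulrC.
move=> z; rewrite -subr_ge0.
have gz0 : 0 < gauss_dens w z by exact: gauss_dens_gt0.
have -> : k (z, y) * (f1 z * l1 z) -
    ((l2 y + 1) * (f1 z * k (z, y)) - r * (gauss_dens w z * k (z, y))) =
    k (z, y) * (f1 z * (l1 z - l2 y) - f1 z + gauss_dens w z * r) by ring.
apply: mulr_ge0 => //.
set q := gauss_dens w z * r / f1 z.
have q0 : 0 < q by rewrite divr_gt0// mulr_gt0.
have -> : l1 z - l2 y = - ln q.
  rewrite /l1 /l2 /logratio -/f1 -/f2 -/r -ln_div ?posrE ?divr_gt0// -lnV ?posrE//.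
  by congr ln; rewrite /q; field; rewrite !gt_eqF.
have -> : gauss_dens w z * r = f1 z * q by rewrite /q [RHS]mulrC divfK ?gt_eqF.
rewrite -{2}[f1 z]mulr1 -mulrBr -mulrDr mulr_ge0 ?(ltW (f10 z))//.
have := @le_ln1Dx _ (q - 1).
rewrite addrCA subrr addr0 => /(_ _)/wrap[]; last by lra.
by rewrite -subr_gt0 opprK subrK.
Qed.

(** [log_sum] is integrated over [y]; after exchanging the integrals the kernel disappears, since it
    has unit mass in [y]. *)
Lemma kl_data_processing : kl (v + b) (w + b) P <= kl v w P.
Proof.
have ml : measurable_fun setT (fun z => f1 z * l1 z).
  apply: measurable_funM; first exact: (proj1 gf1).
  exact: (measurable_logratio v0 w0 Prho).
have kE x : (\int[lebn R n]_y (k (x, y))%:E = 1%:E)%E by exact: integral_gauss.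
have gl1 : gdom (fun z => f1 z * l1 z) by exact: (gdomM_logratio v0 w0 rho0 Prho).
have hw : (lebn R n).-integrable setT (fun z => (1 * (f1 z * l1 z))%:E).
  by under eq_fun do rewrite mul1r; exact: gdom_integrable.
have gl2 : gdom (fun z => f2 z * l2 z).
  apply: (gdomM_logratio vb0 _ rho0 Prho); first exact: addr_gt0.
  exact: (gdom_out_dens vb0 Prho).
have E1 : (kl v w P)%:E = (\int[lebn R n]_z (1 * (f1 z * l1 z))%:E)%E.
  by under eq_integral do rewrite mul1r; rewrite (EFin_Rintegral gl1).
have E2 : (kl (v + b) (w + b) P)%:E = (\int[lebn R n]_z (f2 z * l2 z)%:E)%E.
  by rewrite (EFin_Rintegral gl2).
have E3 := etrans E1 (esym (integral_kernel ml mk k0 kE hw)).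
rewrite -lee_fin [leLHS]E2 [leRHS]E3.
apply: le_integral => //.
- exact: gdom_integrable.
- exact: (integrable_kernel_integral ml mk k0 kE hw).
move=> y _; rewrite EFin_Rintegral ?lee_fin ?log_sum//.
by have := gdom_k y gl1; under eq_fun do rewrite mulrC.
Qed.

End kl_data_processing.

(** * Gaussian inputs conditioned on a shell *)

Section density_probability.
Local Open Scope ereal_scope.
Context d (T : measurableType d) (R : realType).
Variables (mu : {measure set T -> \bar R}) (dens : T -> R).

(* The proofs are arguments so that the canonical probability structure below
   can be inferred from the term. *)
Definition density_prob of measurable_fun setT dens &
    (forall x, (0 <= dens x)%R) & \int[mu]_x (dens x)%:E = 1 :=
  fun A => \int[mu]_(x in A) (dens x)%:E.

Variables (mdens : measurable_fun setT dens) (dens0 : forall x, (0 <= dens x)%R).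
Hypothesis dens1 : \int[mu]_x (dens x)%:E = 1.

Local Notation Q := (density_prob mdens dens0 dens1).

Let Q0 : Q set0 = 0. Proof. by rewrite /density_prob integral_set0. Qed.

Let Q_ge0 A : 0 <= Q A.
Proof. by apply: integral_ge0 => x _; rewrite lee_fin. Qed.

Let Q_sigma_additive : semi_sigma_additive Q.
Proof.
move=> /= F mF tF mUF; rewrite /density_prob; apply: cvg_toP.
  apply: ereal_nondecreasing_is_cvgn => m n mn.
  apply: lee_sum_nneg_natr => // k _ _.
  by apply: integral_ge0 => /= x Fkx; rewrite lee_fin.
rewrite ge0_integral_bigcup//=.
- by apply: measurable_funTS; exact: measurableT_comp.
- by move=> x _; rewrite lee_fin.
Qed.

HB.instance Definition _ := isMeasure.Build _ _ _ Q Q0 Q_ge0 Q_sigma_additive.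

HB.instance Definition _ := @Measure_isProbability.Build _ _ R Q dens1.

Import HBNNSimple.

Let integral_density_nnsfun (f : {nnsfun T >-> R}) :
  \int[Q]_x (f x)%:E = \int[mu]_x (f x * dens x)%:E.
Proof.
have mi r : measurable_fun [set: T] (\1_(f @^-1` [set r]) : T -> R) by [].
transitivity (\sum_(r \in range f) \int[mu]_x
    (r * (\1_(f @^-1` [set r]) x * dens x))%:E); last first.
  rewrite -ge0_integral_fsum//.
  - apply: eq_integral => x _; rewrite fsumEFin// [in RHS]fimfunE.
    rewrite !fsbig_finite//= mulr_suml; congr EFin.
    by apply: eq_bigr => r _; rewrite mulrA.
  - move=> r; apply/measurable_EFinP; do 2 apply: measurable_funM => //.
  - by move=> r x _; rewrite mulrA EFinM mule_ge0 ?nnfun_muleindic_ge0 ?lee_fin.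
under eq_integral do rewrite fimfunE -fsumEFin//.
rewrite ge0_integral_fsum//; last 2 first.
- by move=> r; apply/measurable_EFinP; exact: measurable_funM.
- by move=> r x _; rewrite EFinM nnfun_muleindic_ge0.
apply: eq_fsbigr => r /[!inE] -[x0 _ rE].
have r0 : (0 <= r)%R by rewrite -rE.
under eq_integral do rewrite EFinM.
under [RHS]eq_integral do rewrite EFinM.
rewrite !ge0_integralZl ?lee_fin//.
- rewrite integral_indic// setIT; congr (_ * _).
  rewrite /= /density_prob [LHS]integral_mkcond; apply: eq_integral => x _.
  by rewrite patchE indicE; case: ifP => _; rewrite ?mul1r ?mul0r.
- exact/measurable_EFinP/measurable_funM.
- by move=> x _; rewrite lee_fin mulr_ge0.
- exact/measurable_EFinP.
Qed.

(** Change of density, passed from simple functions to [h] by monotone convergence on both sides. *)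
Lemma ge0_integral_density_prob (h : T -> R) :
  measurable_fun setT h -> (forall x, (0 <= h x)%R) ->
  \int[Q]_x (h x)%:E = \int[mu]_x (h x * dens x)%:E.
Proof.
move=> mh h0.
have mhE : measurable_fun setT (EFin \o h) by exact/measurable_EFinP.
pose h_ := nnsfun_approx measurableT mhE.
have ndh x : nondecreasing_seq (fun n => (h_ n x)%:E).
  by move=> ? ? mn; rewrite lee_fin; exact/lefP/nd_nnsfun_approx.
have cvh x : (h_ n x)%:E @[n --> \oo] --> (h x)%:E.
  by apply: cvg_nnsfun_approx => // y _; rewrite lee_fin.
transitivity (limn (fun n => \int[Q]_x (h_ n x)%:E)).
  rewrite -monotone_convergence//=.
  - by apply: eq_integral => x _; apply/esym/cvg_lim => //; exact: cvh.
  - by move=> n; exact/measurable_EFinP/measurable_funTS.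
  - by move=> n x _; rewrite lee_fin.
transitivity (limn (fun n => \int[mu]_x (h_ n x * dens x)%:E)).
  by apply: congr_lim; apply/funext => n; exact: integral_density_nnsfun.
rewrite -monotone_convergence//=.
- apply: eq_integral => x _; apply/cvg_lim => //.
  under eq_fun do rewrite EFinM.
  by rewrite EFinM; apply: cvgeZr => //; exact: cvh.
- by move=> n; apply/measurable_EFinP; exact: measurable_funM.
- by move=> n x _; rewrite lee_fin mulr_ge0.
- move=> x _ m n mn; rewrite !EFinM lee_pmul ?lee_fin//.
  by have := ndh x m n mn; rewrite lee_fin.
Qed.

End density_probability.

Section prob1.
Context d (T : measurableType d) (R : realType) (P : probability T R).

Lemma prob1_ae (A : set T) : measurable A -> P A = 1%E -> {ae P, forall x, A x}.
Proof.
move=> mA PA1; exists (~` A); split => //; first exact: measurableC.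
by rewrite probability_setC// PA1 subee.
Qed.

End prob1.

(** * Exponential tail bounds for the squared norm *)

Section chernoff.
Variables (R : realType) (n : nat).
Implicit Types t u : R.

(** Equals [expR (- (u - 1 - ln u) / 2)] for [u > 0]: the per-coordinate factor given by Cramer's
    bound for a squared norm that is [u] times its mean. It is below 1 except at the tangency point
    [u = 1]. *)
Definition chernoff_rate u : R := Num.sqrt (u * expR (1 - u)).

Lemma chernoff_rate_ge0 u : 0 <= chernoff_rate u.
Proof. exact: sqrtr_ge0. Qed.

Lemma chernoff_rate_lt1 u : 0 < u -> u != 1 -> chernoff_rate u < 1.
Proof.
move=> u0 u1; rewrite /chernoff_rate -[ltRHS]sqrtr1 ltr_sqrt//.
have := @expR_gt1Dx _ (u - 1); rewrite subr_eq0 addrCA subrr addr0 => /(_ u1).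
by rewrite -[1 - u]opprB expRN ltr_pdivrMr ?expR_gt0// mul1r.
Qed.

(* For [u > 1] this bounds the upper tail [|x|^2 >= u t n], for [u < 1] the
   lower tail [|x|^2 <= u t n]. *)
Lemma chernoff t u (x : n.-tuple R) : 0 < t -> 0 < u ->
  0 <= (u - 1) * (sqn x - u * t * n%:R) ->
  gauss_dens t x <= chernoff_rate u ^+ n * gauss_dens (u * t) x.
Proof.
move=> t0 u0 H; have ut0 : 0 < u * t by exact: mulr_gt0.
have p0 : 0 < pi *+ 2 :> R by rewrite pmulrn_lgt0// pi_gt0.
have C0 : 0 < chernoff_rate u.
  by rewrite sqrtr_gt0 mulr_gt0// expR_gt0.
have g0 : 0 < gauss_dens (u * t) x by exact: gauss_dens_gt0.
have Cn0 : 0 < chernoff_rate u ^+ n by exact: exprn_gt0.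
rewrite -ler_ln ?posrE ?gauss_dens_gt0 ?(mulr_gt0 Cn0 g0)//.
rewrite lnM ?posrE// !ln_gauss_dens// lnXn//.
have lnC : ln (chernoff_rate u) = (ln u + (1 - u)) / 2.
  have : ln (chernoff_rate u ^+ 2) = ln u + (1 - u).
    rewrite /chernoff_rate sqr_sqrtr ?mulr_ge0 ?expR_ge0 ?(ltW u0)//.
    by rewrite lnM ?posrE ?expR_gt0// expRK.
  by rewrite lnXn// => <-; field.
have := ln_peak n t0 ut0; rewrite mulfK ?gt_eqF// => lp.
rewrite -[_ *+ n]mulr_natl lnC.
(* The left side is the logarithm of the ratio of the two sides of the claim; the right side shows
   that its sign is that of [H]. *)
have E : sqn x / (t *+ 2) - sqn x / (u * t *+ 2) - n%:R * (u - 1) / 2 =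
    (u - 1) * (sqn x - u * t * n%:R) / (u * t *+ 2).
  by field; rewrite !gt_eqF.
have : 0 <= (u - 1) * (sqn x - u * t * n%:R) / (u * t *+ 2).
  by rewrite divr_ge0// mulrn_wge0// (ltW ut0).
rewrite -E; lra.
Qed.

End chernoff.

(** * Bounds on the secrecy difference for one input law *)

Section secrecy_bounds.
Variables (R : realType) (n : nat) (v1 v2 : R).
Hypotheses (v10 : 0 < v1) (v12 : v1 < v2).

Let v20 : 0 < v2. Proof. exact: lt_trans v12. Qed.

(** Here [t] is a power per coordinate; the factor one half of the limit is kept outside. *)
Definition rate (t : R) : R := ln ((1 + t / v1) / (1 + t / v2)).

Lemma rateE t : 0 <= t -> rate t = ln ((t + v1) / v1) - ln ((t + v2) / v2).
Proof.
move=> t0; have t1 : 0 < t + v1 by exact: ltr_wpDl.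
have t2 : 0 < t + v2 by exact: ltr_wpDl.
rewrite -ln_div ?posrE ?divr_gt0// /rate; congr (ln (_ / _)).
  by field; rewrite gt_eqF.
by field; rewrite gt_eqF.
Qed.

Variables (rho t : R) (P : probability (n.-tuple R) R).
Hypotheses (rho0 : 0 <= rho) (t0 : 0 <= t).
Hypothesis Prho : {ae P, forall x, sqn x <= rho}.

Let p : R := fine (\int[P]_x (sqn x)%:E)%E.

Let pE : (\int[P]_x (sqn x)%:E)%E = p%:E.
Proof.
by rewrite /p fineK//; apply: (integrable_fin_num _ (integrable_sqn rho0 Prho)).
Qed.

Let mq : measurable_fun [set: n.-tuple R] (fun x => (sqn x)%:E).
Proof. by apply/measurable_EFinP; exact: measurable_sqn_id. Qed.

Let p_le : p <= rho.
Proof.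
rewrite -lee_fin -pE -[leRHS]mule1 -(probability_setT P) -integral_cst//.
apply: ae_ge0_le_integral => //.
- by move=> x _; rewrite lee_fin sqn_ge0.
- by apply: filterS Prho => x xr _; rewrite lee_fin.
Qed.

Let le_p (r : R) : 0 <= r -> {ae P, forall x, r <= sqn x} -> r <= p.
Proof.
move=> r0 Pr.
rewrite -lee_fin -pE -[leLHS]mule1 -(probability_setT P) -integral_cst//.
apply: ae_ge0_le_integral => //.
- by move=> x _; rewrite lee_fin sqn_ge0.
- by apply: filterS Pr => x xr _; rewrite lee_fin.
Qed.

Let t1 : 0 < t + v1. Proof. exact: ltr_wpDl. Qed.
Let t2 : 0 < t + v2. Proof. exact: ltr_wpDl. Qed.
Let kl1 := kl v1 (t + v1) P.
Let kl2 := kl v2 (t + v2) P.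
Let slope := (t + v1)^-1 - (t + v2)^-1.

Let slope_ge0 : 0 <= slope.
Proof. by rewrite subr_ge0 lef_pV2 ?posrE// lerD2l (ltW v12). Qed.

Let slope_le : slope <= v1^-1.
Proof.
have a1 : (t + v1)^-1 <= v1^-1 by rewrite lef_pV2 ?posrE// lerDr.
have a2 : 0 < (t + v2)^-1 by rewrite invr_gt0.
by rewrite /slope; lra.
Qed.

Lemma secrecy_diffE : (mutual_info v1 P - mutual_info v2 P)%E =
  (n%:R / 2 * rate t + (p - n%:R * t) / 2 * slope - (kl1 - kl2))%:E.
Proof.
rewrite (mutual_infoE v10 t1 rho0 Prho) (mutual_infoE v20 t2 rho0 Prho).
rewrite -EFinB -/p -/kl1 -/kl2 rateE// /slope; congr EFin.
set L1 := ln _; set L2 := ln _.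
by field; rewrite !gt_eqF.
Qed.

Lemma secrecy_diff_le : rho <= n%:R * t ->
  (mutual_info v1 P - mutual_info v2 P <= (n%:R / 2 * rate t)%:E)%E.
Proof.
move=> rt; rewrite secrecy_diffE lee_fin.
have b0 : 0 < v2 - v1 by rewrite subr_gt0.
have dp : kl2 <= kl1.
  have := kl_data_processing v10 b0 t1 rho0 Prho.
  by rewrite addrC subrK -addrA [v1 + _]addrC subrK.
have : 0 <= (n%:R * t - p) * slope.
  by rewrite mulr_ge0// subr_ge0 (le_trans p_le).
lra.
Qed.

(** The power may be as low as [n a], which costs at most [(t - a) / v1] because [slope] is at most
    [1 / v1]; [ln M] pays for the divergence at [v1], and the nonnegative one at [v2] is dropped. *)
Lemma secrecy_diff_ge (a M : R) : 0 <= a -> a <= t -> 0 < M ->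
  {ae P, forall x, n%:R * a <= sqn x} ->
  (forall y, out_dens v1 P y <= M * gauss_dens (t + v1) y) ->
  ((n%:R / 2 * (rate t - (t - a) / v1) - ln M)%:E <=
   mutual_info v1 P - mutual_info v2 P)%E.
Proof.
move=> a0 at_ M0 Pa fM; rewrite secrecy_diffE lee_fin.
have k1 : kl1 <= ln M by exact: (kl_le v10 t1 rho0 Prho).
have k2 : 0 <= kl2 by exact: (kl_ge0 v20 t2 rho0 Prho).
have ap : n%:R * a <= p by apply: le_p => //; exact: mulr_ge0.
have s1 : 0 <= (p - n%:R * a) * slope by rewrite mulr_ge0// subr_ge0.
have s2 : 0 <= n%:R * (t - a) * (v1^-1 - slope).
  by rewrite !mulr_ge0// subr_ge0.
lra.
Qed.

End secrecy_bounds.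

(** * Construction of the shell input *)

Section shell_input.
Variables (R : realType) (n : nat) (v a t c2 : R).
Hypotheses (v0 : 0 < v) (a0 : 0 < a) (at_ : a < t) (tc : t < c2).
Hypothesis tail : chernoff_rate (a / t) ^+ n + chernoff_rate (c2 / t) ^+ n <= 2^-1.

Let t0 : 0 < t. Proof. exact: lt_trans at_. Qed.
Let shell : set (n.-tuple R) := [set x | n%:R * a <= sqn x <= n%:R * c2].

Let mshell : measurable shell.
Proof.
have := @measurable_sqn_preimage R n `[n%:R * a, n%:R * c2].
by congr (measurable _); apply/seteqP; split=> x /=; rewrite in_itv.
Qed.

Let mg s : measurable_fun setT (fun x : n.-tuple R => gauss_dens s x).
Proof. exact: (measurable_gauss_dens s (f := id)). Qed.

Let mi : measurable_fun setT (\1_shell : n.-tuple R -> R).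
Proof. exact: measurable_indic. Qed.

Let Z : R := fine (\int[lebn R n]_x (gauss_dens t x * \1_shell x)%:E)%E.

Let ZE : (\int[lebn R n]_x (gauss_dens t x * \1_shell x)%:E)%E = Z%:E.
Proof.
rewrite /Z fineK// ge0_fin_numE; last first.
  by apply: integral_ge0 => x _; rewrite lee_fin mulr_ge0 ?gauss_dens_ge0.
apply: (@le_lt_trans _ _ 1%E); last exact: ltry.
rewrite -(integral_gauss0 n t0); apply: ge0_le_integral => //.
- by move=> x _; rewrite lee_fin mulr_ge0 ?gauss_dens_ge0.
- exact/measurable_EFinP/measurable_funM.
- exact/measurable_EFinP.
- by move=> x _; rewrite lee_fin ler_piMr ?gauss_dens_ge0// indicE.
Qed.

(** A comparison of densities: everywhere, the Gaussian of variance [t] is at most its restriction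
    to the shell plus small multiples of the Gaussians of variance [a] and [c2]. The last two
    dominate it inside and outside the shell by [chernoff] at [u = a / t] and [u = c2 / t].
    Integration gives [1 <= Z + C1 + C2]. *)
Let Z_ge : 2^-1 <= Z.
Proof.
have := tail; set C1 := _ (a / t) ^+ n; set C2 := _ (c2 / t) ^+ n => C12.
have c20 : 0 < c2 by exact: lt_trans tc.
have C10 : 0 <= C1 by rewrite exprn_ge0 ?chernoff_rate_ge0.
have C20 : 0 <= C2 by rewrite exprn_ge0 ?chernoff_rate_ge0.
have at0 : 0 < a / t by exact: divr_gt0.
have ct0 : 0 < c2 / t by exact: divr_gt0.
have H : (1 <= Z%:E + (C1%:E + C2%:E))%E.
  pose h1 (x : n.-tuple R) := (C1 * gauss_dens a x)%:E.
  pose h2 (x : n.-tuple R) := (C2 * gauss_dens c2 x)%:E.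
  pose h0 (x : n.-tuple R) := (gauss_dens t x * \1_shell x)%:E.
  have I C s : 0 <= C -> 0 < s ->
      (\int[lebn R n]_x (C * gauss_dens s x)%:E = C%:E)%E.
    move=> C0 s0; under eq_integral do rewrite EFinM.
    rewrite ge0_integralZl ?lee_fin//.
    - by rewrite integral_gauss0// mule1.
    - exact/measurable_EFinP.
    - by move=> x _; rewrite lee_fin gauss_dens_ge0.
  have m0 : measurable_fun setT h0 by exact/measurable_EFinP/measurable_funM.
  have m1 : measurable_fun setT h1 by exact/measurable_EFinP/measurable_funM.
  have m2 : measurable_fun setT h2 by exact/measurable_EFinP/measurable_funM.
  have p0 x : setT x -> (0 <= h0 x)%E.
    by move=> _; rewrite lee_fin mulr_ge0 ?gauss_dens_ge0.
  have p1 x : setT x -> (0 <= h1 x)%E.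
    by move=> _; rewrite lee_fin mulr_ge0 ?gauss_dens_ge0.
  have p2 x : setT x -> (0 <= h2 x)%E.
    by move=> _; rewrite lee_fin mulr_ge0 ?gauss_dens_ge0.
  have -> : (Z%:E + (C1%:E + C2%:E) = \int[lebn R n]_x (h0 x + (h1 x + h2 x)))%E.
    rewrite ge0_integralD//; last 2 first.
    - by move=> x _; apply: adde_ge0; [exact: p1|exact: p2].
    - exact: emeasurable_funD.
    by rewrite (ge0_integralD _ measurableT p1 m1 p2 m2) -ZE /h1 /h2 !I.
  rewrite -(integral_gauss0 n t0); apply: ge0_le_integral => //.
  - by move=> x _; rewrite lee_fin gauss_dens_ge0.
  - exact/measurable_EFinP.
  - by apply: emeasurable_funD => //; exact: emeasurable_funD.
  move=> x _; rewrite /h0 /h1 /h2 -!EFinD lee_fin indicE.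
  have g0 := gauss_dens_ge0 t x.
  have g1 : 0 <= C1 * gauss_dens a x by rewrite mulr_ge0 ?gauss_dens_ge0.
  have g2 : 0 <= C2 * gauss_dens c2 x by rewrite mulr_ge0 ?gauss_dens_ge0.
  have [xs|] := boolP (x \in shell); first by rewrite mulr1; lra.
  rewrite notin_setE /shell /= mulr0 => /negP; rewrite negb_and -!ltNge => /orP[xa|xc].
  - have := @chernoff _ n t (a / t) x t0 at0.
    rewrite divfK ?gt_eqF// -/C1 => /(_ _)/wrap[]; last by lra.
    rewrite mulr_le0// ?subr_le0 ?ler_pdivrMr ?mul1r ?(ltW at_)//.
    by rewrite mulrC (ltW xa).
  - have := @chernoff _ n t (c2 / t) x t0 ct0.
    rewrite divfK ?gt_eqF// -/C2 => /(_ _)/wrap[]; last by lra.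
    rewrite mulr_ge0// ?subr_ge0 ?ler_pdivlMr ?mul1r ?(ltW tc)//.
    by rewrite mulrC (ltW xc).
by move: H; rewrite -!EFinD lee_fin; lra.
Qed.

Let Z0 : 0 < Z. Proof. by apply: lt_le_trans Z_ge; rewrite invr_gt0. Qed.

Let dens (x : n.-tuple R) := Z^-1 * (gauss_dens t x * \1_shell x).

Let mdens : measurable_fun setT dens.
Proof. by apply: measurable_funM => //; exact: measurable_funM. Qed.

Let dens0 x : 0 <= dens x.
Proof. by rewrite !mulr_ge0 ?gauss_dens_ge0 ?invr_ge0 ?(ltW Z0). Qed.

Let dens1 : (\int[lebn R n]_x (dens x)%:E = 1)%E.
Proof.
under eq_integral do rewrite /dens EFinM.
rewrite ge0_integralZl ?lee_fin ?invr_ge0 ?(ltW Z0)//.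
- by rewrite ZE -EFinM mulVf// gt_eqF.
- exact/measurable_EFinP/measurable_funM.
- by move=> x _; rewrite lee_fin mulr_ge0 ?gauss_dens_ge0.
Qed.

(** Dropping the indicator leaves [Z^-1 <= 2] times the full Gaussian, whose passage through the
    channel is an exact convolution. *)
Lemma ex_shell_input : exists P : probability (n.-tuple R) R,
  P shell = 1%E /\ (forall y, out_dens v P y <= 2 * gauss_dens (t + v) y).
Proof.
exists (density_prob mdens dens0 dens1); split.
  rewrite /= /density_prob integral_mkcond -[RHS]dens1.
  apply: eq_integral => x _; rewrite patchE /dens indicE.
  by case: (x \in shell) => //; rewrite !mulr0.
move=> y; rewrite -lee_fin -out_densE//.
have mgy : measurable_fun setT (fun x : n.-tuple R => gauss_dens v (tsub y x)).
  exact/measurable_gauss_dens/measurable_tsub.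
rewrite ge0_integral_density_prob//; last by move=> x; exact: gauss_dens_ge0.
rewrite -[y in leRHS]tsub0 EFinM -gauss_conv// -ge0_integralZl//; last 2 first.
- apply/measurable_EFinP/measurable_funM => //.
  exact/measurable_gauss_dens/measurable_tsub.
- by move=> x _; rewrite lee_fin mulr_ge0 ?gauss_dens_ge0.
apply: ge0_le_integral => //.
- by move=> x _; rewrite lee_fin mulr_ge0 ?gauss_dens_ge0.
- exact/measurable_EFinP/measurable_funM.
- apply: measurable_funeM; apply/measurable_EFinP/measurable_funM => //.
  exact/measurable_gauss_dens/measurable_tsub.
move=> x _; rewrite -EFinM lee_fin tsub0 /dens.
have g0 := gauss_dens_ge0 t x; have k0 := gauss_dens_ge0 v (tsub y x).
have Z2 : Z^-1 <= 2 by rewrite -div1r ler_pdivrMr//; have := Z_ge; lra.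
have i1 : \1_shell x <= 1 :> R by rewrite indicE; case: (_ \in _).
have i0 : 0 <= \1_shell x :> R by [].
rewrite [leLHS](_ : _ = Z^-1 * \1_shell x * (gauss_dens t x * gauss_dens v (tsub y x))).
  by rewrite ler_wpM2r ?mulr_ge0// -[leRHS]mulr1 ler_pM ?invr_ge0 ?(ltW Z0).
by ring.
Qed.

End shell_input.

(** * The secrecy capacity *)

Section secrecy_capacity.
Variables (R : realType) (v1 v2 : R).
Hypotheses (v10 : 0 < v1) (v12 : v1 < v2).

Let v20 : 0 < v2. Proof. exact: lt_trans v12. Qed.

Lemma measurable_sqn_le n (r : R) : measurable [set x : n.-tuple R | sqn x <= r].
Proof.
have := @measurable_sqn_preimage R n `]-oo, r].
by congr (measurable _); apply/seteqP; split=> x /=; rewrite in_itv.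
Qed.

Lemma ball_inputsE n (c : R) (P : probability (n.-tuple R) R) : 0 <= c ->
  ball_inputs (c * Num.sqrt n%:R) P =
  (P [set x | sqn x <= n%:R * c ^+ 2] = 1%E).
Proof.
move=> c0; set r := c * _.
have r0 : 0 <= r by rewrite mulr_ge0// sqrtr_ge0.
have rE : n%:R * c ^+ 2 = r ^+ 2 by rewrite /r exprMn sqr_sqrtr// mulrC.
rewrite /ball_inputs /=; congr (P _ = _); apply/funext => x /=; congr is_true.
by rewrite rE -enorm_sqr ler_pXn2r// nnegrE ?sqrtr_ge0.
Qed.

Lemma ball_inputs_ae n (c : R) (P : probability (n.-tuple R) R) : 0 <= c ->
  ball_inputs (c * Num.sqrt n%:R) P -> {ae P, forall x, sqn x <= n%:R * c ^+ 2}.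
Proof.
by move=> c0; rewrite ball_inputsE//; apply: prob1_ae; exact: measurable_sqn_le.
Qed.

Lemma Cs_le n (c : R) : 0 <= c ->
  (Cs v1 v2 (c * Num.sqrt n%:R) n <= (n%:R / 2 * rate v1 v2 (c ^+ 2))%:E)%E.
Proof.
move=> c0; apply: ge_ereal_sup => _ [P PB <-].
have Prho := ball_inputs_ae c0 PB.
by apply: (secrecy_diff_le v10 v12 _ _ Prho) => //; rewrite ?mulr_ge0 ?sqr_ge0.
Qed.

Lemma rate0 : rate v1 v2 0 = 0.
Proof. by rewrite /rate !mul0r addr0 divr1 ln1. Qed.

(** With [c = 0] there is no room for [0 < a < t < c^2]. The deterministic input at the origin
    replaces the shell and meets [secrecy_diff_ge] with [a = t = 0] and [M = 1]. *)
Lemma Cs0_ge0 n : (0 <= Cs v1 v2 (0 * Num.sqrt n%:R) n)%E.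
Proof.
pose P : probability (n.-tuple R) R := \d_(tzero R n).
have q0 : sqn (tzero R n) = 0.
  by rewrite /sqn big1// => i _; rewrite tnth_mktuple expr0n.
have PB : ball_inputs (0 * Num.sqrt n%:R) P.
  rewrite /ball_inputs /= diracE mem_set//= /enorm mul0r.
  by rewrite -/(sqn (tzero R n)) q0 sqrtr0.
have c0 : 0 <= 0 :> R by [].
have Prho := ball_inputs_ae c0 PB.
have Pa : {ae P, forall x, n%:R * 0 <= sqn x}.
  by apply: aeW => x; rewrite mulr0 sqn_ge0.
have f1 y : out_dens v1 P y <= 1 * gauss_dens (0 + v1) y.
  rewrite mul1r add0r -lee_fin -out_densE//.
  rewrite integral_dirac//; last first.
    exact/measurable_EFinP/measurable_gauss_dens/measurable_tsub.
  by rewrite diracT mul1e tsub0.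
have n0 : 0 <= n%:R * 0 ^+ 2 :> R by rewrite expr0n mulr0.
have := secrecy_diff_ge v10 v12 n0 c0 Prho c0 (lexx _) ltr01 Pa f1.
rewrite rate0 subrr mul0r subrr mulr0 ln1 subrr => H.
by apply: (le_trans H); apply: ereal_sup_ubound; exists P.
Qed.

Lemma Cs_ge n (c a t : R) : 0 < c -> 0 < a -> a < t -> t < c ^+ 2 ->
  chernoff_rate (a / t) ^+ n + chernoff_rate (c ^+ 2 / t) ^+ n <= 2^-1 ->
  ((n%:R / 2 * (rate v1 v2 t - (t - a) / v1) - ln 2)%:E <=
   Cs v1 v2 (c * Num.sqrt n%:R) n)%E.
Proof.
move=> c0 a0 at_ tc tail.
have [P [PS f1]] := ex_shell_input v10 a0 at_ tc tail.
set S := (X in P X = _) in PS.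
have mS : measurable S.
  have := @measurable_sqn_preimage R n `[n%:R * a, n%:R * c ^+ 2].
  by congr (measurable _); apply/seteqP; split=> x /=; rewrite in_itv.
have PSae := prob1_ae mS PS.
have Prho : {ae P, forall x, sqn x <= n%:R * c ^+ 2}.
  by apply: filterS PSae => x /andP[].
have Pa : {ae P, forall x, n%:R * a <= sqn x}.
  by apply: filterS PSae => x /andP[].
have PB : ball_inputs (c * Num.sqrt n%:R) P.
  rewrite ball_inputsE ?(ltW c0)//; apply/eqP; rewrite eq_le probability_le1.
    rewrite -PS le_measure ?inE// => [|x /andP[]//].
    exact: measurable_sqn_le.
  exact: measurable_sqn_le.
have t0 : 0 <= t by apply: ltW; exact: lt_trans at_.
apply: (@le_trans _ _ (mutual_info v1 P - mutual_info v2 P)%E).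
  apply: (secrecy_diff_ge v10 v12 _ t0 Prho (ltW a0) (ltW at_) _ Pa f1) => //.
  by rewrite mulr_ge0 ?sqr_ge0.
by apply: ereal_sup_ubound; exists P.
Qed.

(** The logarithm with [v2] is nondecreasing and enters negatively; the one with [v1] has slope at
    most [1 / v1]. This controls the loss from taking [t] below [c^2]. *)
Lemma rate_lipschitz (t s : R) : 0 <= t -> t <= s ->
  rate v1 v2 s <= rate v1 v2 t + (s - t) / v1.
Proof.
move=> t0 ts; have s0 := le_trans t0 ts.
have pos u v : 0 <= u -> 0 < v -> 0 < (u + v) / v.
  by move=> u0 v0; rewrite divr_gt0// ltr_wpDl.
rewrite !rateE//.
have m2 : ln ((t + v2) / v2) <= ln ((s + v2) / v2).
  by rewrite ler_ln ?posrE ?pos// ler_pM2r ?invr_gt0// lerD2r.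
have m1 : ln ((s + v1) / v1) - ln ((t + v1) / v1) <= (s - t) / v1.
  rewrite -ln_div ?posrE ?pos//.
  have tv : 0 < t + v1 by exact: ltr_wpDl.
  rewrite (_ : _ / _ = 1 + (s - t) / (t + v1)); last by field; rewrite !gt_eqF.
  apply: (@le_trans _ _ ((s - t) / (t + v1))).
    apply: le_ln1Dx; apply: (@lt_le_trans _ _ 0) => //.
    by rewrite divr_ge0 ?subr_ge0 ?(ltW tv).
  by rewrite ler_wpM2l ?subr_ge0// lef_pV2 ?posrE// lerDr.
lra.
Qed.

Lemma Cs_eventually_ge (c e : R) : 0 <= c -> 0 < e ->
  \forall n \near \oo, ((rate v1 v2 (c ^+ 2) / 2 - e)%:E <=
    Cs v1 v2 (c * Num.sqrt n%:R) n * (n%:R^-1)%:E)%E.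
Proof.
rewrite le_eqVlt => /orP[/eqP <- e0|c0 e0].
  near=> n; rewrite expr0n /= rate0 mul0r sub0r.
  apply: (@le_trans _ _ 0%E); first by rewrite lee_fin oppr_le0 ltW.
  by apply: mule_ge0; [exact: Cs0_ge0|rewrite lee_fin invr_ge0].
have c20 : 0 < c ^+ 2 by rewrite exprn_gt0.
(* The first entry keeps [a = c^2 - 2 d] positive. By the second, the gaps [c^2 - t = t - a = d]
   cost [d / (2 v1)] each, together at most [e / 2]; the other [e / 2] is left for [ln 2 / n]. *)
pose d := Num.min (c ^+ 2 / 4) (e * v1 / 2).
have d0 : 0 < d by rewrite lt_min !divr_gt0// mulr_gt0.
have dc : d <= c ^+ 2 / 4 by rewrite /d ge_min lexx.
have de : d <= e * v1 / 2 by rewrite /d ge_min lexx orbT.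
pose t := c ^+ 2 - d; pose a := c ^+ 2 - 2 * d.
have a0 : 0 < a by rewrite /a; lra.
have at_ : a < t by rewrite /a /t; lra.
have tc : t < c ^+ 2 by rewrite /t; lra.
have t0 : 0 < t by exact: lt_trans at_.
have C1 : chernoff_rate (a / t) < 1.
  by rewrite chernoff_rate_lt1 ?divr_gt0// lt_eqF// ltr_pdivrMr// mul1r.
have C2 : chernoff_rate (c ^+ 2 / t) < 1.
  by rewrite chernoff_rate_lt1 ?divr_gt0// gt_eqF// ltr_pdivlMr// mul1r.
(* A quarter for each of the two tails makes up the one half required by [Cs_ge]. *)
have tail u : chernoff_rate u < 1 ->
    \forall n \near \oo, chernoff_rate u ^+ n <= 4^-1 :> R.
  move=> u1; have := @cvg_expr R (chernoff_rate u).
  rewrite ger0_norm ?chernoff_rate_ge0// => /(_ u1) /cvgrPdist_le /(_ 4^-1 _)/wrap[].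
    by rewrite invr_gt0.
  apply: filterS => n; rewrite sub0r normrN ger0_norm//.
  by rewrite exprn_ge0// chernoff_rate_ge0.
near=> n.
have n0 : (0 < n)%N by near: n; exists 1%N.
have nR0 : 0 < n%:R :> R by rewrite ltr0n.
have tl : chernoff_rate (a / t) ^+ n + chernoff_rate (c ^+ 2 / t) ^+ n <= 2^-1 :> R.
  have T1 : chernoff_rate (a / t) ^+ n <= 4^-1 :> R by near: n; exact: tail.
  have T2 : chernoff_rate (c ^+ 2 / t) ^+ n <= 4^-1 :> R by near: n; exact: tail.
  lra.
have ln2n : ln 2 / n%:R <= e / 2 :> R.
  have : 2 * ln 2 / e <= n%:R :> R by near: n; exact: nbhs_infty_ger.
  rewrite ler_pdivrMr// => H.
  by rewrite ler_pdivrMr//; lra.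
have H := Cs_ge c0 a0 at_ tc tl.
have ni0 : (0 <= (n%:R^-1)%:E :> \bar R)%E by rewrite lee_fin invr_ge0.
apply: le_trans (lee_wpmul2r ni0 H); rewrite -EFinM lee_fin.
have -> : (n%:R / 2 * (rate v1 v2 t - (t - a) / v1) - ln 2) / n%:R =
    rate v1 v2 t / 2 - (t - a) / v1 / 2 - ln 2 / n%:R :> R.
  by field; rewrite !gt_eqF.
have L := rate_lipschitz (ltW t0) (ltW tc).
have D1 : (t - a) / v1 = d / v1 by rewrite /t /a; congr (_ / _); ring.
have D2 : (c ^+ 2 - t) / v1 = d / v1 by rewrite /t; congr (_ / _); ring.
have D3 : d / v1 <= e / 2 by rewrite ler_pdivrMr//; lra.
rewrite D1; rewrite D2 in L; lra.
Unshelve. all: by end_near.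
Qed.

End secrecy_capacity.

Theorem theorem7 (R : realType) (v1 v2 c c0 : R) :
  0 < v1 -> v1 < v2 -> assumptionA R ->
  0 <= c0 -> is_cstar v1 v2 c0 -> 0 <= c <= c0 ->
  (fun n : nat => (Cs v1 v2 (c * Num.sqrt n%:R) n * (n%:R^-1)%:E)%E) @ \oo -->
    ((2^-1 * ln ((1 + c ^+ 2 / v1) / (1 + c ^+ 2 / v2)))%:E)%E.
Proof.
move=> v10 v12 _ _ _ /andP[c0' _].
rewrite -/(rate v1 v2 (c ^+ 2)) mulrC; set L := rate _ _ _ / 2.
pose s n := (Cs v1 v2 (c * Num.sqrt n%:R) n * (n%:R^-1)%:E)%E.
have up : \forall n \near \oo, (s n <= L%:E)%E.
  near=> n; have nR0 : 0 < n%:R :> R by rewrite ltr0n; near: n; exists 1%N.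
  have ni0 : (0 <= (n%:R^-1)%:E :> \bar R)%E by rewrite lee_fin invr_ge0.
  apply: (le_trans (lee_wpmul2r ni0 (Cs_le v10 v12 n c0'))).
  rewrite -EFinM lee_fin /L (_ : _ / n%:R = rate v1 v2 (c ^+ 2) / 2)//.
  by field; rewrite gt_eqF.
have lo e : 0 < e -> \forall n \near \oo, ((L - e)%:E <= s n)%E.
  exact: Cs_eventually_ge.
(* The limit is checked on real values, so [s n] must eventually be finite; the upper bound and the
   lower bound with [e = 1] give this. *)
have fin : \forall n \near \oo, s n \is a fin_num.
  near=> n; rewrite fin_numE; apply/andP; split.
    rewrite -ltNye; apply: (@lt_le_trans _ _ (L - 1)%:E); first exact: ltNyr.
    by near: n; exact: lo.
  by rewrite -ltey; apply: (@le_lt_trans _ _ L%:E); [near: n|exact: ltry].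
apply/fine_cvgP; split; first exact: fin.
apply/cvgrPdist_le => e e0; near=> n.
have f : s n \is a fin_num by near: n.
have u : (s n <= L%:E)%E by near: n.
have l : ((L - e)%:E <= s n)%E by near: n; exact: lo.
rewrite /= -/(s n); move: u l; rewrite -(fineK f) !lee_fin /= => u l.
by rewrite ler_norml; apply/andP; split; lra.
Unshelve. all: by end_near.
Qed.
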